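(* There exists a positive integer $t$ such that for each pair of integers $(t_1,t_2)$ with $t_1\ge t_2\ge t$, any graph that is cospectral with the $2$-clique extension of the $(t_1\times t_2)$-grid is the slim graph of a $2$-fat $\{\mathfrak{f}_1,\mathfrak{f}_2,\mathfrak{f}_3\}$-line Hoffman graph.
   Context: All graphs are finite, undirected and simple. Two graphs are cospectral if their adjacency matrices have the same spectrum (as multisets of eigenvalues). The $(t_1\times t_2)$-grid is the Cartesian product $K_{t_1}\Box K_{t_2}$ (equivalently, the line graph of $K_{t_1,t_2}$). The $2$-clique extension of a graph $G$ with adjacency matrix $A$ is the graph with adjacency matrix $\begin{pmatrix}A & A+I\\ A+I & A\end{pmatrix}$ (each vertex is replaced by a $2$-clique, and vertices from different cliques are adjacent iff the original vertices are). A Hoffman graph $\mathfrak{h}$ is a pair $(H,\ell)$ where $H=(V,E)$ is a graph and $\ell:V\to\{\text{fat},\text{slim}\}$ is a labeling such that no two fat vertices are adjacent and every fat vertex has at least one slim neighbor. The slim graph of $\mathfrak{h}$ is the subgraph of $H$ induced on the slim vertices (an ordinary graph). $\mathfrak{h}$ is $t$-fat if every slim vertex has at least $t$ fat neighbors. An induced Hoffman subgraph of $\mathfrak{h}$ is a Hoffman graph $(H_1,\ell_1)$ with $H_1$ an induced subgraph of $H$ and $\ell_1$ the restriction of $\ell$. For a set $W$ of slim vertices, the induced Hoffman subgraph generated by $W$ is the one induced on $W$ together with all fat vertices having a neighbor in $W$. Isomorphisms of Hoffman graphs are graph isomorphisms preserving labels. The special matrix $S(\mathfrak{h})$ is indexed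 by slim vertices: $S(\mathfrak{h})=A_{\rm slim}-CC^T$, where $A_{\rm slim}$ is the adjacency matrix of the slim graph and $C$ is the slim-by-fat $0/1$ adjacency block. A family $\{\mathfrak{h}^i\}_{i=1}^r$ is a decomposition of $\mathfrak{h}$, written $\mathfrak{h}=\uplus_{i=1}^r\mathfrak{h}^i$, if there is a partition of the slim vertex set of $\mathfrak{h}$ into $r$ parts such that $\mathfrak{h}^i$ is the induced Hoffman subgraph generated by the $i$-th part and $S(\mathfrak{h})$ is block diagonal with blocks $S(\mathfrak{h}^1),\dots,S(\mathfrak{h}^r)$ with respect to this partition. For a family $\mathfrak{H}$ of pairwise non-isomorphic Hoffman graphs, a Hoffman graph $\mathfrak{h}$ is an $\mathfrak{H}$-line Hoffman graph if there is a Hoffman graph $\mathfrak{h}'$ such that $\mathfrak{h}'$ has $\mathfrak{h}$ as an induced Hoffman subgraph, $\mathfrak{h}'$ has the same slim graph as $\mathfrak{h}$, and $\mathfrak{h}'=\uplus_{i=1}^r\mathfrak{h}'_i$ where each $\mathfrak{h}'_i$ is isomorphic to an induced Hoffman subgraph of some member of $\mathfrak{H}$. The Hoffman graphs $\mathfrak{f}_1,\mathfrak{f}_2,\mathfrak{f}_3$: - $\mathfrak{f}_1$ has one slim vertex adjacent to three fat vertices. - $\mathfrak{f}_2$ has four slim vertices $x_1,x_2,y_1,y_2$ and four fat vertices $F_{ij}$ ($i,j\in\{1,2\}$); the slim-slim edges are exactly $x_1x_2$ and $y_1y_2$; $x_i$ is adjacent to exactly the fat vertices $F_{i1},F_{i2}$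 and $y_j$ to exactly $F_{1j},F_{2j}$. - $\mathfrak{f}_3$ has two adjacent slim vertices and two fat vertices, each slim vertex being adjacent to both fat vertices. *)

(* Defs.v *)
From HB Require Import structures.
From mathcomp Require Import all_boot all_order all_algebra all_field.

Set Implicit Arguments.
Unset Strict Implicit.
Unset Printing Implicit Defensive.

Import Order.TTheory GRing.Theory Num.Theory.
Local Open Scope ring_scope.

(** * Finite simple graphs *)

Record sgraph := SGraph {
  vertex :> finType;
  adj : rel vertex;
  adj_sym : symmetric adj;
  adj_irr : irreflexive adj }.

Definition sgraph_iso (G H : sgraph) (f : G -> H) : Prop :=
  bijective f /\ forall x y : G, adj (f x) (f y) = adj x y.

Definition sgraph_isomorphic (G H : sgraph) : Prop :=
  exists f : G -> H, sgraph_iso f.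

Section InducedSubgraph.
Variables (G : sgraph) (U : {set G}).
Definition induced_rel : rel {x : G | x \in U} :=
  fun x y => adj (val x) (val y).
Lemma induced_sym : symmetric induced_rel.
Proof. by move=> x y; apply: adj_sym. Qed.
Lemma induced_irr : irreflexive induced_rel.
Proof. by move=> x; apply: adj_irr. Qed.
Definition induced_sgraph : sgraph := SGraph induced_sym induced_irr.
End InducedSubgraph.

Section Complete.
Variable n : nat.
Definition complete_rel : rel 'I_n := fun i j => i != j.
Lemma complete_sym : symmetric complete_rel.
Proof. by move=> i j; rewrite /complete_rel eq_sym. Qed.
Lemma complete_irr : irreflexive complete_rel.
Proof. by move=> i; rewrite /complete_rel eqxx. Qed.
Definition complete_graph : sgraph := SGraph complete_sym complete_irr.
End Complete.

Section CartesianProduct.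
Variables G H : sgraph.
Definition cartesian_rel : rel (G * H)%type := fun u v =>
  (u.1 == v.1) && adj u.2 v.2 || (u.2 == v.2) && adj u.1 v.1.
Lemma cartesian_sym : symmetric cartesian_rel.
Proof.
by move=> u v; rewrite /cartesian_rel ![u.1 == _]eq_sym ![u.2 == _]eq_sym
  (adj_sym u.2) (adj_sym u.1).
Qed.
Lemma cartesian_irr : irreflexive cartesian_rel.
Proof. by move=> u; rewrite /cartesian_rel !adj_irr !andbF. Qed.
Definition cartesian_product : sgraph := SGraph cartesian_sym cartesian_irr.
End CartesianProduct.

Definition grid (t1 t2 : nat) : sgraph :=
  cartesian_product (complete_graph t1) (complete_graph t2).

(* The Boolean selects one of the two blocks of rows (columns) of
   [A, A + I; A + I, A]. *)
Section CliqueExtension.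
Variable G : sgraph.
Definition clique_ext2_rel : rel (G * bool)%type := fun u v =>
  adj u.1 v.1 || (u.1 == v.1) && (u.2 != v.2).
Lemma clique_ext2_sym : symmetric clique_ext2_rel.
Proof.
by move=> u v; rewrite /clique_ext2_rel (adj_sym u.1) ![u.1 == _]eq_sym
  ![u.2 == _]eq_sym.
Qed.
Lemma clique_ext2_irr : irreflexive clique_ext2_rel.
Proof. by move=> u; rewrite /clique_ext2_rel adj_irr !eqxx. Qed.
Definition clique_ext2 : sgraph := SGraph clique_ext2_sym clique_ext2_irr.
End CliqueExtension.

(** * Spectra *)

Definition adjacency_mx (R : nzRingType) (G : sgraph) : 'M[R]_#|G| :=
  \matrix_(i, j) (adj (enum_val i) (enum_val j))%:R.

Definition eigenvalue_mult n (A : 'M[algC]_n) (a : algC) : nat :=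
  mup a (char_poly A).

(* A multiset of eigenvalues is given by its multiplicity function; algC
   contains every eigenvalue of an integer matrix. *)
Definition cospectral (G H : sgraph) : Prop :=
  forall a : algC, eigenvalue_mult (adjacency_mx algC G) a =
                   eigenvalue_mult (adjacency_mx algC H) a.

(** * Hoffman graphs *)

Record hoffman := Hoffman {
  hgraph :> sgraph;
  fat : pred hgraph;
  fat_nonadj : forall x y : hgraph, fat x -> fat y -> ~~ adj x y;
  fat_slim : forall x : hgraph, fat x -> exists2 y, ~~ fat y & adj x y }.

Definition hoffman_isomorphic (h k : hoffman) : Prop :=
  exists2 f : h -> k, sgraph_iso f & forall x : h, fat (f x) = fat x.

Definition fat_set (h : hoffman) : {set h} := [set x | fat x].
Definition slim_set (h : hoffman) : {set h} := [set x | ~~ fat x].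

Definition slim_graph (h : hoffman) : sgraph := induced_sgraph (slim_set h).

Definition t_fat (t : nat) (h : hoffman) : Prop :=
  forall x : h, ~~ fat x -> (t <= #|[set f in fat_set h | adj x f]|)%N.

Definition hoffman_set (h : hoffman) (U : {set h}) : Prop :=
  forall x, x \in U -> fat x -> exists y, [/\ y \in U, ~~ fat y & adj x y].

Section InducedHoffman.
Variables (h : hoffman) (U : {set h}) (hU : hoffman_set U).
Definition induced_fat : pred (induced_sgraph U) := fun x => fat (val x).
Lemma induced_fat_nonadj (x y : induced_sgraph U) :
  induced_fat x -> induced_fat y -> ~~ adj x y.
Proof. exact: fat_nonadj. Qed.
Lemma induced_fat_slim (x : induced_sgraph U) :
  induced_fat x -> exists2 y, ~~ induced_fat y & adj x y.
Proof.
by move=> /(hU (valP x))[y [yU sy xy]]; exists (Sub y yU : induced_sgraph U).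
Qed.
Definition induced_hoffman : hoffman :=
  Hoffman induced_fat_nonadj induced_fat_slim.
End InducedHoffman.

Section Generated.
Variables (h : hoffman) (W : {set slim_graph h}).
Definition generated_set : {set h} :=
  [set val w | w in W] :|: [set f in fat_set h | [exists w in W, adj (val w) f]].
Lemma generated_setP : hoffman_set generated_set.
Proof.
move=> x; rewrite inE => /orP[/imsetP[w _ ->] fw|].
  by have := valP w; rewrite inE fw.
rewrite inE => /andP[_ /existsP[w /andP[wW wx]]] _; exists (val w); split.
- by rewrite inE imset_f.
- by have := valP w; rewrite inE.
- by rewrite adj_sym.
Qed.
Definition generated_hoffman : hoffman := induced_hoffman generated_setP.
End Generated.

(** * Special matrix and decompositions *)

Definition slim_fat_mx (h : hoffman) : 'M[int]_(#|slim_graph h|, #|fat_set h|) :=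
  \matrix_(i, j) (adj (val (enum_val i)) (enum_val j))%:R.

Definition special_mx (h : hoffman) : 'M[int]_#|slim_graph h| :=
  adjacency_mx int (slim_graph h) - slim_fat_mx h *m (slim_fat_mx h)^T.

Definition special_entry (h : hoffman) (x y : slim_graph h) : int :=
  special_mx h (enum_rank x) (enum_rank y).

(* The family {h^i} is [generated_hoffman W] for W ranging over the parts of P.
   Two slim vertices x of h and u of [generated_hoffman W] are identified when
   they have the same underlying vertex of h. *)
Definition decomposition (h : hoffman) (P : {set {set slim_graph h}}) : Prop :=
  [/\ partition P [set: slim_graph h],
      forall W, W \in P ->
        forall (x y : slim_graph h) (u v : slim_graph (generated_hoffman W)),
          val x = val (val u) -> val y = val (val v) ->
          special_entry x y = special_entry u v
    & forall W1 W2, W1 \in P -> W2 \in P -> W1 != W2 ->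
        forall x y, x \in W1 -> y \in W2 -> special_entry x y = 0].

(* In the first conjunct below, U induces a copy of h; since the slim graph of
   h is an induced subgraph of that of h', the two slim graphs coincide exactly
   when U contains every slim vertex of h'. *)
Definition line_hoffman (I : Type) (H : I -> hoffman) (h : hoffman) : Prop :=
  exists h' : hoffman,
    (exists (U : {set h'}) (hU : hoffman_set U),
       hoffman_isomorphic h (induced_hoffman hU) /\ slim_set h' \subset U) /\
    (exists P : {set {set slim_graph h'}}, decomposition P /\
       forall W, W \in P ->
         exists (i : I) (U : {set H i}) (hU : hoffman_set U),
           hoffman_isomorphic (generated_hoffman W) (induced_hoffman hU)).

(** * The Hoffman graphs f1, f2, f3 *)

(* The Hoffman graph with slim vertices S, fat vertices F, slim-slim adjacency a
   and slim-fat adjacency c. *)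
Section Build.
Variables (S F : finType) (a : rel S) (c : S -> F -> bool).
Hypotheses (a_sym : symmetric a) (a_irr : irreflexive a).
Hypothesis c_slim : forall f, exists s, c s f.
Definition build_rel : rel (S + F)%type := fun x y =>
  match x, y with
  | inl s, inl s' => a s s'
  | inl s, inr f => c s f
  | inr f, inl s => c s f
  | inr _, inr _ => false
  end.
Lemma build_sym : symmetric build_rel.
Proof. by move=> [s|f] [s'|f'] //=. Qed.
Lemma build_irr : irreflexive build_rel.
Proof. by move=> [s|f] /=. Qed.
Definition build_sgraph : sgraph := SGraph build_sym build_irr.
Definition build_fat : pred build_sgraph := fun x => if x is inr _ then true else false.
Lemma build_fat_nonadj (x y : build_sgraph) :
  build_fat x -> build_fat y -> ~~ adj x y.
Proof. by case: x => // f; case: y. Qed.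
Lemma build_fat_slim (x : build_sgraph) :
  build_fat x -> exists2 y, ~~ build_fat y & adj x y.
Proof.
by case: x => // f _; have [s sf] := c_slim f; exists (inl s : build_sgraph).
Qed.
Definition build_hoffman : hoffman := Hoffman build_fat_nonadj build_fat_slim.
End Build.

Definition f1_slim_rel : rel unit := fun _ _ => false.
Definition f1_inc (s : unit) (f : 'I_3) : bool := true.
Lemma f1_sym : symmetric f1_slim_rel. Proof. by []. Qed.
Lemma f1_irr : irreflexive f1_slim_rel. Proof. by []. Qed.
Lemma f1_inc_slim f : exists s, f1_inc s f. Proof. by exists tt. Qed.
Definition hoff_f1 : hoffman := build_hoffman f1_sym f1_irr f1_inc_slim.

(* (false, i) is x_i, (true, j) is y_j, and the fat vertex (i, j) is F_ij. *)
Definition f2_slim_rel : rel (bool * bool)%type :=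
  fun s s' => (s.1 == s'.1) && (s.2 != s'.2).
Definition f2_inc (s f : bool * bool) : bool :=
  s.2 == (if s.1 then f.2 else f.1).
Lemma f2_sym : symmetric f2_slim_rel.
Proof. by move=> [[] []] [[] []]. Qed.
Lemma f2_irr : irreflexive f2_slim_rel.
Proof. by move=> [[] []]. Qed.
Lemma f2_inc_slim f : exists s, f2_inc s f.
Proof. by exists (false, f.1); rewrite /f2_inc /=. Qed.
Definition hoff_f2 : hoffman := build_hoffman f2_sym f2_irr f2_inc_slim.

Definition f3_slim_rel : rel bool := fun s s' => s != s'.
Definition f3_inc (s f : bool) : bool := true.
Lemma f3_sym : symmetric f3_slim_rel. Proof. by move=> [] []. Qed.
Lemma f3_irr : irreflexive f3_slim_rel. Proof. by case. Qed.
Lemma f3_inc_slim f : exists s, f3_inc s f. Proof. by exists true. Qed.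
Definition hoff_f3 : hoffman := build_hoffman f3_sym f3_irr f3_inc_slim.

Definition f_family (i : 'I_3) : hoffman :=
  match val i with 0 => hoff_f1 | 1 => hoff_f2 | _ => hoff_f3 end.

Lemma hoffman_isomorphic_card (h k : hoffman) :
  hoffman_isomorphic h k -> #|h| = #|k|.
Proof. by case=> f [/bij_eq_card]. Qed.

Lemma hoffman_isomorphic_card_fat (h k : hoffman) :
  hoffman_isomorphic h k -> #|fat_set h| = #|fat_set k|.
Proof.
case=> f [fB _] ff; have <- : [set f x | x in fat_set h] = fat_set k.
  apply/setP=> y; case: fB => g fK gK; apply/imsetP/idP.
    by case=> x; rewrite !inE => fx ->; rewrite ff.
  by move=> fy; exists (g y); rewrite ?gK // inE -ff gK -in_set.
by rewrite card_imset //; apply: bij_inj.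
Qed.

Lemma f_family_pairwise_nonisomorphic (i j : 'I_3) :
  i != j -> ~ hoffman_isomorphic (f_family i) (f_family j).
Proof.
have c1 : #|hoff_f1| = 4 by rewrite /= card_sum card_unit card_ord.
have c2 : #|hoff_f2| = 8 by rewrite /= card_sum !card_prod !card_bool.
have c3 : #|hoff_f3| = 4 by rewrite /= card_sum !card_bool.
have fatE (S F : finType) (a : rel S) (c : S -> F -> bool)
    (a_sym : symmetric a) (a_irr : irreflexive a)
    (c_slim : forall f, exists s, c s f) :
    #|fat_set (build_hoffman a_sym a_irr c_slim)| = #|F|.
  rewrite -(card_codom (@inr_inj S F)); apply: eq_card => -[s|f].
    by rewrite inE; apply/esym/negbTE/codomP=> -[].
  by rewrite inE codom_f.
have fat1 : #|fat_set hoff_f1| = 3 by rewrite fatE card_ord.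
have fat3 : #|fat_set hoff_f3| = 2 by rewrite fatE card_bool.
move=> nij ij; have := hoffman_isomorphic_card_fat ij.
have := hoffman_isomorphic_card ij; move: nij {ij}.
case: i => [[|[|[|//]]] ?]; case: j => [[|[|[|//]]] ?] //=;
  by rewrite /f_family /= ?c1 ?c2 ?c3 ?fat1 ?fat3.
Qed.

(* Main.v *)
(** Any graph cospectral with the 2-clique extension of a grid has the same
    spectral bounds: its adjacency matrix A satisfies A + 3I >= 0, it is
    k-regular with k = 2(t1 + t2) - 3, and A <= 2 t1 - 3 on vectors of sum zero.
    These pass between cospectral graphs because symmetric matrices with the
    same characteristic polynomial are unitarily similar.

    For a large clique C let Q(C) be the set of vertices with few non-neighbours
    in C; the fat vertices are the sets Q(C).  Indicator vectors of cliques,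
    scaled by 1/N, behave under A + 3I like fat vertices up to an error O(1/N),
    so integrality makes the special matrix S satisfy w^T (S + 3I) w >= 0 for
    all small integer vectors w.  By Ramsey's theorem (there is no induced
    K_{1,10}) and the eigenvalue bound on vectors of sum zero, |Q(C)| is at most
    2 t1 + O(1) < k, so the neighbourhood of each vertex contains large cliques
    of two different classes: every vertex lies in at least two fat sets.

    Then S + 3I has diagonal entries in {0, 1}, and its nonzero entries split
    the vertices with exactly two fat neighbours into classes on which S + 3I is
    v v^T for a vector v of signs.  A class with both signs is the slim part of
    f_3 or of an induced subgraph of f_2; to a class with one sign we attach a
    new fat vertex, after which each of its vertices is an f_1. *)

Require Import Defs.
From mathcomp Require Import all_boot all_order all_algebra all_field.
From mathcomp Require Import perm.
From mathcomp Require Import ring lra zify.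

Set Implicit Arguments.
Unset Strict Implicit.
Unset Printing Implicit Defensive.

Import Order.TTheory GRing.Theory Num.Theory.
Local Open Scope ring_scope.
Local Open Scope sesquilinear_scope.

(** * Spectral bounds *)

Lemma char_poly_conj (F : fieldType) n (P A : 'M[F]_n) :
  P \in unitmx -> char_poly (invmx P *m A *m P) = char_poly A.
Proof.
move=> uP; rewrite /char_poly /char_poly_mx !map_mxM /=.
set Q := map_mx polyC P; set Q' := map_mx polyC (invmx P).
have QQ : Q' *m Q = 1%:M by rewrite -map_mxM /= mulVmx // map_mx1.
have -> : 'X%:M - Q' *m map_mx polyC A *m Q =
          Q' *m ('X%:M - map_mx polyC A) *m Q.
  rewrite mulmxBr mulmxBl; congr (_ - _).
  by rewrite mul_mx_scalar -scalemxAl QQ scalemx1.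
rewrite !det_mulmx mulrAC -det_mulmx QQ det1 mul1r //.
Qed.

(** Both matrices are unitarily diagonalisable, and a permutation matches their lists of
    eigenvalues. The orders differ in the statement because the two graphs have different vertex
    types; they agree because these lists have the same length. *)
Lemma normal_cospectral_similar m n (A : 'M[algC]_m) (B : 'M[algC]_n) :
    A \is normalmx -> B \is normalmx ->
    (forall a, mup a (char_poly A) = mup a (char_poly B)) ->
  exists U : 'M[algC]_(n, m),
    [/\ U^t* *m U = 1%:M, U *m U^t* = 1%:M & A = U^t* *m B *m U].
Proof.
move=> nA nB muAB.
have char_spectral k (M : 'M[algC]_k) : M \is normalmx ->
    char_poly M = \prod_(y <- [seq spectral_diag M 0 i | i <- enum 'I_k]) ('X - y%:P).
  move=> /orthomx_spectralP eM.
  rewrite {1}eM char_poly_conj ?spectral_unit //.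
  rewrite char_poly_trig ?diag_mx_is_trig // big_map big_enum /=.
  by apply: eq_bigr => i _; rewrite mxE eqxx mulr1n.
have pAB : perm_eq [seq spectral_diag A 0 i | i <- enum 'I_m]
                   [seq spectral_diag B 0 i | i <- enum 'I_n].
  apply/allP => x _ /=; rewrite -!mu_prod_XsubC.
  by rewrite -(char_spectral _ _ nA) -(char_spectral _ _ nB) muAB.
have emn : m = n by have := perm_size pAB; rewrite !size_map -!enumT !size_enum_ord.
subst m.
have /tuple_permP[s es] : perm_eq [seq spectral_diag A 0 i | i <- enum 'I_n]
   (mktuple (fun i : 'I_n => spectral_diag B 0 i)).
  by rewrite (perm_trans pAB) // perm_refl.
have dAB i : spectral_diag A 0 i = spectral_diag B 0 (s i).
  have := congr1 (nth 0 ^~ (val i)) es.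
  rewrite /= (nth_map i) ?size_enum_ord // nth_ord_enum => ->.
  by rewrite (nth_map i) -?enumT ?size_enum_ord // nth_ord_enum tnth_mktuple.
have uA := spectral_unitarymx A; have uB := spectral_unitarymx B.
have uP : perm_mx s \is @unitarymx algC n n.
  by apply/unitarymxP; rewrite tr_perm_mx map_perm_mx -perm_mxM mulgV perm_mx1.
(* [U] passes to the eigenbasis of [A], permutes the coordinates, and returns from the eigenbasis of
   [B]. *)
exists (invmx (spectralmx B) *m (perm_mx s)^t* *m spectralmx A).
set U := _ *m _ *m _.
have uU : U \is unitarymx.
  by rewrite /U invmx_unitary // !mul_unitarymx ?trmxC_unitary.
have e2 : U *m U^t* = 1%:M by exact/unitarymxP.
have e1 : U^t* *m U = 1%:M.
  by move: uU; rewrite -trmxC_unitary => /unitarymxP; rewrite trmxCK.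
split=> //.
rewrite [in LHS](orthomx_spectralP nA) [in RHS](orthomx_spectralP nB).
have -> : diag_mx (spectral_diag A) =
    perm_mx s *m diag_mx (spectral_diag B) *m (perm_mx s)^t*.
  rewrite -row_permE tr_perm_mx map_perm_mx.
  have -> : perm_mx s^-1 = perm_mx s^-1%g :> 'M[algC]_n by [].
  rewrite -col_permE; apply/matrixP => i j; rewrite !mxE dAB.
  by rewrite (inj_eq perm_inj).
rewrite /U !invmx_unitary // !trmx_mul !map_mxM /= !trmxCK !mulmxA.
rewrite -(mulmxA _ (spectralmx B)) (unitarymxP uB) mulmx1.
by rewrite -(mulmxA _ (spectralmx B)) (unitarymxP uB) mulmx1.
Qed.

(** The Hermitian form of the adjacency matrix, on functions on the vertices and so free of the
    enumeration behind matrix indices. *)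
Definition adjacency_form (G : sgraph) (u v : G -> algC) : algC :=
  \sum_x \sum_y (adj x y)%:R * u x * (v y)^*.

Lemma sum_vertex_ord (R : nmodType) (G : finType) (f : G -> R) :
  \sum_x f x = \sum_(i < #|G|) f (enum_val i).
Proof. by rewrite (reindex _ (onW_bij _ (@enum_val_bij G))). Qed.

Definition fun_col (G : finType) (u : G -> algC) : 'cV[algC]_#|G| :=
  \col_i u (enum_val i).

Lemma dot_fun_col (G : finType) (u v : G -> algC) :
  \sum_x u x * (v x)^* = ((fun_col v)^t* *m fun_col u) 0 0.
Proof.
rewrite sum_vertex_ord mxE; apply: eq_bigr => i _.
by rewrite !mxE mulrC.
Qed.

Lemma adjacency_form_fun_col (G : sgraph) (u v : G -> algC) :
  adjacency_form u v =
  ((fun_col v)^t* *m (adjacency_mx algC G *m fun_col u)) 0 0.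
Proof.
rewrite /adjacency_form exchange_big sum_vertex_ord mxE.
apply: eq_bigr => i _; rewrite sum_vertex_ord !mxE mulr_sumr.
by apply: eq_bigr => j _; rewrite !mxE adj_sym mulrC.
Qed.

Lemma adjacency_mx_normal (G : sgraph) : adjacency_mx algC G \is normalmx.
Proof.
apply/hermitian_normalmx/realsym_hermsym.
  apply/is_hermitianmxP; rewrite expr0 scale1r.
  by apply/matrixP => i j; rewrite !mxE adj_sym.
by apply/mxOverP => i j; rewrite mxE realn.
Qed.

(** The trace of the square depends only on the spectrum, so cospectral graphs have equally many
    edges. *)
Lemma tr_adjacency_mx_sqr (G : sgraph) :
  \tr (adjacency_mx algC G *m adjacency_mx algC G) =
  \sum_(x : G) \sum_(y : G) (adj x y)%:R.
Proof.
rewrite /mxtrace (@sum_vertex_ord _ G); apply: eq_bigr => i _.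
rewrite mxE (@sum_vertex_ord _ G); apply: eq_bigr => j _.
by rewrite !mxE [adj (enum_val j) _]adj_sym -natrM mulnb andbb.
Qed.

(** [T] is the unitary similarity seen as a map on functions. Nothing yet says that it preserves
    constants; the edge count is recorded in order to prove that. *)
Lemma cospectral_isometry (G H : sgraph) : cospectral G H ->
  [/\ #|G| = #|H|,
      \sum_(x : G) \sum_(y : G) (adj x y)%:R =
        \sum_(x : H) \sum_(y : H) (adj x y)%:R :> algC
    & exists T : (G -> algC) -> (H -> algC), forall u v,
        \sum_x T u x * (T v x)^* = \sum_x u x * (v x)^* /\
        adjacency_form (T u) (T v) = adjacency_form u v].
Proof.
move=> /(normal_cospectral_similar (adjacency_mx_normal G) (adjacency_mx_normal H)).
move=> [U [U1 U2 AGH]].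
have trH : \tr (adjacency_mx algC G *m adjacency_mx algC G) =
           \tr (adjacency_mx algC H *m adjacency_mx algC H).
  rewrite AGH !mulmxA -(mulmxA _ U (U^t*)) U2 mulmx1 mxtrace_mulC.
  by rewrite !mulmxA U2 mul1mx.
split; last 2 first.
- by rewrite -!tr_adjacency_mx_sqr.
- pose T (u : G -> algC) (y : H) := (U *m fun_col u) (enum_rank y) 0.
  have TE u : fun_col (T u) = U *m fun_col u.
    by apply/matrixP => i j; rewrite mxE /T enum_valK ord1.
  exists T => u v; rewrite !dot_fun_col !adjacency_form_fun_col !TE.
  rewrite AGH !trmx_mul !map_mxM /=.
  by rewrite !mulmxA -(mulmxA _ (U^t*) U) U1 mulmx1.
have : \tr (U^t* *m U) = \tr (U *m U^t*) by rewrite mxtrace_mulC.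
by rewrite U1 U2 !mxtrace1 => /eqP; rewrite eqr_nat => /eqP.
Qed.

(* For the row, column and cell maps this splits the form of the extended grid
   into sums of squares. *)
Lemma sum_same_fibre (X I : finType) (f : X -> I) (u v : X -> algC) :
  \sum_x \sum_y (f x == f y)%:R * u x * (v y)^* =
  \sum_i (\sum_(x | f x == i) u x) * (\sum_(x | f x == i) v x)^*.
Proof.
rewrite (partition_big f predT) //=; apply: eq_bigr => i _.
rewrite mulr_suml; apply: eq_bigr => x /eqP fx.
rewrite rmorph_sum mulr_sumr [RHS]big_mkcond /=; apply: eq_bigr => y _.
by rewrite fx eq_sym; case: eqP => _; rewrite ?mul1r ?mul0r.
Qed.

(** Two vertices of one cell share a row and a column, so the cell term removes a double count; the
    last term clears the diagonal. *)
Lemma adj_grid_ext t1 t2 (x y : clique_ext2 (grid t1 t2)) :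
  (adj x y)%:R = (x.1.1 == y.1.1)%:R + (x.1.2 == y.1.2)%:R
                 - (x.1 == y.1)%:R - (x == y)%:R :> algC.
Proof.
case: x y => [[i j] b] [[i' j'] b'] /=.
rewrite /clique_ext2_rel /= /cartesian_rel /= /complete_rel -!pair_eqE /= !xpair_eqE.
by case: (i == i'); case: (j == j'); case: (b == b') => /=; ring.
Qed.

(** * Spectral bounds for the 2-clique extension of a grid *)

Section GridExtension.
Variables t1 t2 : nat.
Notation H := (clique_ext2 (grid t1 t2)).
Implicit Types u v w : H -> algC.

Definition cell_sum u (i : 'I_t1) (j : 'I_t2) : algC :=
  u ((i, j), false) + u ((i, j), true).

Lemma sum_grid_ext u : \sum_x u x = \sum_i \sum_j cell_sum u i j.
Proof.
rewrite pair_bigA /= [RHS](eq_bigr (fun p => \sum_b u (p, b))); last first.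
  by move=> [i j] _; rewrite big_bool /= addrC.
by rewrite pair_bigA /=; apply: eq_bigr => -[[]].
Qed.

Lemma sum_row u i : \sum_(x : H | x.1.1 == i) u x = \sum_j cell_sum u i j.
Proof.
rewrite big_mkcond (sum_grid_ext (fun x => if x.1.1 == i then u x else 0)).
rewrite (bigD1 i) //= [X in _ + X]big1 ?addr0 => [|i' /negPf ni].
  by apply: eq_bigr => j _; rewrite /cell_sum /= eqxx.
by rewrite big1 // => j _; rewrite /cell_sum /= ni addr0.
Qed.

Lemma sum_column u j : \sum_(x : H | x.1.2 == j) u x = \sum_i cell_sum u i j.
Proof.
rewrite big_mkcond (sum_grid_ext (fun x => if x.1.2 == j then u x else 0)).
apply: eq_bigr => i _; rewrite (bigD1 j) //= big1 ?addr0 => [|j' /negPf nj].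
  by rewrite /cell_sum /= eqxx.
by rewrite /cell_sum /= nj addr0.
Qed.

Lemma sum_cell u p : \sum_(x : H | x.1 == p) u x = cell_sum u p.1 p.2.
Proof.
rewrite big_mkcond (sum_grid_ext (fun x => if x.1 == p then u x else 0)).
case: p => i j; rewrite (bigD1 i) //= (bigD1 j) //=.
rewrite [X in _ + X + _]big1 => [|j' /negPf nj]; last first.
  by rewrite /cell_sum -!pair_eqE /= nj andbF addr0.
rewrite [X in _ + X]big1 => [|i' /negPf ni]; last first.
  by rewrite big1 // => j' _; rewrite /cell_sum -!pair_eqE /= ni addr0.
by rewrite !addr0 /cell_sum /= !eqxx.
Qed.

Lemma adjacency_form_grid_ext u v :
  adjacency_form u v =
    \sum_i (\sum_j cell_sum u i j) * (\sum_j cell_sum v i j)^*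
  + \sum_j (\sum_i cell_sum u i j) * (\sum_i cell_sum v i j)^*
  - \sum_i \sum_j cell_sum u i j * (cell_sum v i j)^*
  - \sum_x u x * (v x)^*.
Proof.
have -> : adjacency_form u v =
    \sum_(x : H) \sum_(y : H) (x.1.1 == y.1.1)%:R * u x * (v y)^*
  + \sum_(x : H) \sum_(y : H) (x.1.2 == y.1.2)%:R * u x * (v y)^*
  - \sum_(x : H) \sum_(y : H) (x.1 == y.1)%:R * u x * (v y)^*
  - \sum_(x : H) \sum_(y : H) (x == y)%:R * u x * (v y)^*.
  rewrite -big_split -!sumrB /=; apply: eq_bigr => x _.
  rewrite -big_split -!sumrB /=; apply: eq_bigr => y _.
  by rewrite adj_grid_ext; ring.
rewrite (sum_same_fibre (fun x : H => x.1.1)) (sum_same_fibre (fun x : H => x.1.2)).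
rewrite (sum_same_fibre (fun x : H => x.1)) (sum_same_fibre (fun x : H => x)).
congr (_ + _ - _ - _).
- by apply: eq_bigr => i _; rewrite !sum_row.
- by apply: eq_bigr => i _; rewrite !sum_column.
- rewrite pair_bigA; apply: eq_bigr => p _; rewrite !sum_cell //.
- by apply: eq_bigr => x _; rewrite !big_pred1_eq.
Qed.

(** The constant function is an eigenvector: a row has [2 * t2] vertices, a column [2 * t1], and the
    cell and the vertex itself account for the 3. *)
Lemma adjacency_form_grid_ext1 v :
  adjacency_form (fun=> 1) v = (2 * (t1 + t2)%:R - 3) * \sum_x (v x)^*.
Proof.
have V2 : \sum_x (v x)^* = \sum_i \sum_j (cell_sum v i j)^*.
  rewrite sum_grid_ext; apply: eq_bigr => i _; apply: eq_bigr => j _.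
  by rewrite [in RHS]/cell_sum rmorphD.
rewrite adjacency_form_grid_ext.
have c1 i j : cell_sum (fun=> 1) i j = 2 by rewrite /cell_sum; ring.
have c1r i : \sum_j cell_sum (fun=> 1) i j = t2%:R * 2.
  by rewrite (eq_bigr _ (fun j _ => c1 i j)) sumr_const card_ord mulr_natl.
have c1c j : \sum_i cell_sum (fun=> 1) i j = t1%:R * 2.
  by rewrite (eq_bigr _ (fun i _ => c1 i j)) sumr_const card_ord mulr_natl.
set V := \sum_x (v x)^* in V2 *.
have -> : \sum_i (\sum_j cell_sum (fun=> 1) i j) * (\sum_j cell_sum v i j)^* =
    t2%:R * 2 * V.
  by rewrite V2 mulr_sumr; apply: eq_bigr => i _; rewrite c1r rmorph_sum.
have -> : \sum_j (\sum_i cell_sum (fun=> 1) i j) * (\sum_i cell_sum v i j)^* =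
    t1%:R * 2 * V.
  rewrite V2 exchange_big mulr_sumr; apply: eq_bigr => j _.
  by rewrite c1c rmorph_sum.
have -> : \sum_i \sum_j cell_sum (fun=> 1) i j * (cell_sum v i j)^* = 2 * V.
  rewrite V2 mulr_sumr; apply: eq_bigr => i _; rewrite mulr_sumr.
  by apply: eq_bigr => j _; rewrite c1.
have -> : \sum_x 1 * (v x)^* = V by apply: eq_bigr => x _; rewrite mul1r.
by rewrite natrD; ring.
Qed.

(** The parallelogram identity in one cell. It turns [2 * S - P] in both bounds below into a sum of
    squares. *)
Lemma sqr_cell_sum u i j :
  2 * cell_sum (fun x => u x * (u x)^*) i j =
  cell_sum u i j * (cell_sum u i j)^* +
  (u ((i, j), false) - u ((i, j), true)) * (u ((i, j), false) - u ((i, j), true))^*.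
Proof. by rewrite /cell_sum rmorphD rmorphB /=; ring. Qed.

(** The form of [A + 3I] is a sum of squares: of row sums, of column sums, and of differences inside
    the cells. *)
Lemma adjacency_form_grid_ext_ge u :
  - 3 * \sum_x u x * (u x)^* <= adjacency_form u u.
Proof.
rewrite adjacency_form_grid_ext -subr_ge0.
set P := \sum_i \sum_j _; set R := \sum_(i < t1) _; set K := \sum_(j < t2) _.
set S := \sum_x _.
rewrite [X in 0 <= X](_ : _ = R + K + (2 * S - P)); last by ring.
have -> : 2 * S - P = \sum_i \sum_j
  (u ((i, j), false) - u ((i, j), true)) * (u ((i, j), false) - u ((i, j), true))^*.
  rewrite /S sum_grid_ext mulr_sumr /P -sumrB; apply: eq_bigr => i _.
  rewrite mulr_sumr -sumrB; apply: eq_bigr => j _.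
  by rewrite sqr_cell_sum addrAC subrr add0r.
rewrite !addr_ge0 // sumr_ge0 // => i _; rewrite ?mul_conjC_ge0 //.
by rewrite sumr_ge0 // => j _; rewrite mul_conjC_ge0.
Qed.

(** Cauchy-Schwarz with its remainder, the squared deviation from the mean. *)
Lemma sum_sqr_mean n (a : 'I_n -> algC) : (0 < n)%N ->
  n%:R * \sum_i a i * (a i)^* =
  (\sum_i a i) * (\sum_i a i)^* +
  n%:R * \sum_i (a i - (\sum_i a i) / n%:R) * (a i - (\sum_i a i) / n%:R)^*.
Proof.
move=> n0; set s := \sum_i a i.
have nz : n%:R != 0 :> algC by rewrite pnatr_eq0 -lt0n.
set m := s / n%:R.
have -> : \sum_i (a i - m) * (a i - m)^* =
    \sum_i (a i * (a i)^*) - m^* * s - m * s^* + n%:R * (m * m^*).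
  have -> : n%:R * (m * m^*) = \sum_(i < n) m * m^*.
    by rewrite sumr_const card_ord mulr_natl.
  rewrite [s^*]rmorph_sum [m^* * s]mulr_sumr mulr_sumr -!sumrB -big_split /=.
  by apply: eq_bigr => i _; rewrite rmorphB /=; ring.
by rewrite /m rmorphM fmorphV /= conjC_nat; field.
Qed.

(** The gap is [(t1 - 1) * (2 * S - P)], nonnegative cell by cell, plus [t1 * P - R - K].
    Subtracting column means from the cell sums uses up [K] and keeps the row sums, since the total
    is zero; Cauchy-Schwarz in each row then bounds [R], as [t2 <= t1]. *)
Lemma adjacency_form_grid_ext_le u : (0 < t2)%N -> (t2 <= t1)%N ->
  \sum_x u x = 0 ->
  adjacency_form u u <= (2 * t1%:R - 3) * \sum_x u x * (u x)^*.
Proof.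
move=> t20 t21; rewrite sum_grid_ext => u0.
have t10 : (0 < t1)%N by apply: leq_trans t21.
have nz : t1%:R != 0 :> algC by rewrite pnatr_eq0 -lt0n.
rewrite adjacency_form_grid_ext -subr_ge0.
set P := \sum_i \sum_j _; set R := \sum_(i < t1) _; set K := \sum_(j < t2) _.
set S := \sum_x _.
pose d i j := u ((i, j), false) - u ((i, j), true).
have PS : 2 * S - P = \sum_i \sum_j d i j * (d i j)^*.
  rewrite /S sum_grid_ext mulr_sumr /P -sumrB; apply: eq_bigr => i _.
  rewrite mulr_sumr -sumrB; apply: eq_bigr => j _.
  by rewrite sqr_cell_sum addrAC subrr add0r.
have -> : (2 * t1%:R - 3) * S - (R + K - P - S) =
    (t1%:R - 1) * (2 * S - P) + (t1%:R * P - R - K) by ring.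
apply: addr_ge0.
  rewrite PS mulr_ge0 ?subr_ge0 ?ler1n //.
  by rewrite sumr_ge0 // => i _; rewrite sumr_ge0 // => j _; rewrite mul_conjC_ge0.
pose c j := \sum_i cell_sum u i j.
pose q i j := cell_sum u i j - c j / t1%:R.
have PQ : t1%:R * P = K + \sum_i \sum_j t1%:R * (q i j * (q i j)^*).
  rewrite /P exchange_big mulr_sumr /= [X in _ + X]exchange_big -big_split /=.
  by apply: eq_bigr => j _; rewrite sum_sqr_mean // mulr_sumr.
have qr i : \sum_j q i j = \sum_j cell_sum u i j.
  rewrite sumrB -mulr_suml [X in X / _](_ : _ = 0) ?mul0r ?subr0 //.
  by rewrite /c exchange_big.
rewrite PQ [K + _]addrC addrAC addrK subr_ge0.
apply: ler_sum => i _; rewrite -qr.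
apply: (@le_trans _ _ (t2%:R * \sum_j q i j * (q i j)^*)).
  rewrite sum_sqr_mean // lerDl mulr_ge0 ?ler0n //.
  by rewrite sumr_ge0 // => j _; rewrite mul_conjC_ge0.
rewrite mulr_sumr; apply: ler_sum => j _.
by rewrite ler_wpM2r ?mul_conjC_ge0 ?ler_nat.
Qed.

Lemma card_grid_ext : #|H| = (2 * (t1 * t2))%N.
Proof. by rewrite !card_prod !card_ord card_bool mulnC. Qed.

End GridExtension.

(** * Transfer of the bounds to a cospectral graph *)

Lemma adjacency_formC (G : sgraph) (u v : G -> algC) :
  adjacency_form u v = (adjacency_form v u)^*.
Proof.
rewrite /adjacency_form exchange_big rmorph_sum; apply: eq_bigr => x _.
rewrite rmorph_sum; apply: eq_bigr => y _.
by rewrite !rmorphM /= conjCK adj_sym conjC_nat mulrAC.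
Qed.

(** The crux is that [T] maps the constant function to a constant. Degrees are then read off by
    pairing it with a point, and having sum zero is orthogonality to it. *)
Lemma cospectral_grid_ext_forms (G : sgraph) (t1 t2 : nat) :
    (0 < t2)%N -> (t2 <= t1)%N -> cospectral G (clique_ext2 (grid t1 t2)) ->
  [/\ forall x : G, \sum_y (adj x y)%:R = 2 * (t1 + t2)%:R - 3 :> algC,
      forall u : G -> algC, - 3 * \sum_x u x * (u x)^* <= adjacency_form u u
    & forall u : G -> algC, \sum_x u x = 0 ->
        adjacency_form u u <= (2 * t1%:R - 3) * \sum_x u x * (u x)^*].
Proof.
move=> t20 t21 cGH; have [cG eG [T TP]] := cospectral_isometry cGH.
set H := clique_ext2 _ in cGH cG eG T TP.
set k : algC := 2 * (t1 + t2)%:R - 3.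
have t10 : (0 < t1)%N by apply: leq_trans t21.
pose n : algC := #|H|%:R.
have n0 : n != 0.
  by rewrite /n card_grid_ext pnatr_eq0 -lt0n !muln_gt0 t10 t20.
have sum1 : \sum_(x : H) (1 : algC) = n by rewrite sumr_const.
have sumG1 : \sum_(x : G) (1 : algC) = n by rewrite sumr_const cG.
pose one : G -> algC := fun=> 1; pose a := (\sum_x T one x) / n.
pose w x := T one x - a.
have sw : \sum_x w x = 0.
  by rewrite sumrB sumr_const -mulr_natl -/n /a mulrC divfK ?subrr.
have sw' : \sum_x (w x)^* = 0 by rewrite -rmorph_sum sw rmorph0.
have aT x : T one x = a + w x by rewrite /w addrC subrK.
have normT : n * (a * a^*) + \sum_x w x * (w x)^* = n.
  have [+ _] := TP one one.
  rewrite [in X in _ = X -> _](eq_bigr (fun=> 1)); last first.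
    by move=> x _; rewrite mul1r conjC1.
  rewrite sumG1 => eT; rewrite -[RHS]eT.
  rewrite [LHS](_ : _ = \sum_(x : H) a * a^* + \sum_x w x * (w x)^* +
    (\sum_x w x) * a^* + a * \sum_x (w x)^*); last first.
    by rewrite sw sw' mul0r mulr0 !addr0 sumr_const -mulr_natl.
  rewrite mulr_suml mulr_sumr -!big_split /=.
  by apply: eq_bigr => x _; rewrite aT [(a + w x)^*]rmorphD /=; ring.
have form_const (v : H -> algC) : adjacency_form (fun=> a) v = k * a * \sum_x (v x)^*.
  rewrite mulrAC -adjacency_form_grid_ext1 /adjacency_form mulr_suml.
  apply: eq_bigr => x _; rewrite mulr_suml; apply: eq_bigr => y _.
  by ring.
have formD (v : H -> algC) : adjacency_form (T one) v =
    adjacency_form (fun=> a) v + adjacency_form w v.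
  rewrite /adjacency_form -big_split; apply: eq_bigr => x _.
  by rewrite -big_split; apply: eq_bigr => y _; rewrite aT /=; ring.
have formT : adjacency_form (T one) (T one) = k * (n * (a * a^*)) + adjacency_form w w.
  rewrite formD form_const; congr (_ + _).
    under eq_bigr => x _ do rewrite aT rmorphD.
    rewrite big_split /= sw' addr0 sumr_const -mulr_natl -/n; ring.
  by rewrite adjacency_formC formD form_const sw' mulr0 add0r -adjacency_formC.
have formG : adjacency_form one one = k * n.
  rewrite /adjacency_form.
  under eq_bigr => x _ do under eq_bigr => y _ do rewrite !mulr1 conjC1 mulr1.
  have -> : n = \sum_(x : H) (1 : algC)^* by rewrite conjC1 sum1.
  rewrite eG -adjacency_form_grid_ext1.
  apply: eq_bigr => x _; apply: eq_bigr => y _.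
  by rewrite conjC1 !mulr1.
(* Equal edge counts make the form of [w] equal to [k] times its squared norm, but sum zero allows a
   factor of at most [2 * t1 - 3], which is smaller by [2 * t2]. *)
have w0 : \sum_x w x * (w x)^* = 0.
  have [_] := TP one one; rewrite formT formG => e1.
  have := adjacency_form_grid_ext_le t20 t21 sw.
  have -> : adjacency_form w w = k * \sum_x w x * (w x)^*.
    have -> : adjacency_form w w = k * n - k * (n * (a * a^*)).
      by rewrite -e1 addrC addKr.
    by rewrite -{1}normT; ring.
  rewrite -subr_ge0 -mulrBl => w1; apply/eqP; rewrite eq_le.
  rewrite [X in _ && X]sumr_ge0 ?andbT => [|x _]; last exact: mul_conjC_ge0.
  move: w1; rewrite [X in X * _](_ : _ = - (2 * t2)%:R); last first.
    by rewrite /k natrD natrM; ring.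
  by rewrite mulNr oppr_ge0 pmulr_rle0 // ltr0n muln_gt0.
have wx0 x : w x = 0.
  have /(_ w0 x isT)/eqP :=
    psumr_eq0P (P := predT) (F := fun x => w x * (w x)^*) (fun x _ => mul_conjC_ge0 _).
  by rewrite mul_conjC_eq0 => /eqP.
have Tone : T one =1 (fun=> a) by move=> x; rewrite aT wx0 addr0.
have a0 : a != 0.
  apply: contra_neq n0 => a0; move: normT; rewrite a0 w0 => <-; ring.
split.
- move=> x; pose d (y : G) : algC := (y == x)%:R.
  have [e1 e2] := TP one d.
  have : \sum_y one y * (d y)^* = 1.
    rewrite (bigD1 x) //= big1 ?addr0 => [|y /negPf yx].
      by rewrite /one /d eqxx conjC1 mulr1.
    by rewrite /d yx conjC0 mulr0.
  rewrite -e1 => e3.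
  have <- : adjacency_form one d = \sum_y (adj x y)%:R.
    rewrite /adjacency_form; apply: eq_bigr => y _.
    rewrite (bigD1 x) //= big1 ?addr0 => [|z /negPf yx].
      by rewrite /d eqxx conjC1 !mulr1 adj_sym.
    by rewrite /d yx conjC0 mulr0.
  have -> : adjacency_form one d = k * a * \sum_y (T d y)^*.
    rewrite -form_const -e2 /adjacency_form.
    by apply: eq_bigr => z _; apply: eq_bigr => y _; rewrite Tone.
  rewrite -mulrA mulr_sumr -[RHS]mulr1 -e3; congr (_ * _).
  by apply: eq_bigr => y _; rewrite Tone.
- move=> u; have [<- <-] := TP u u; exact: adjacency_form_grid_ext_ge.
- move=> u u0; have [<- <-] := TP u u; apply: adjacency_form_grid_ext_le => //.
  have [e1 _] := TP u one.
  have : (\sum_x T u x) * a^* = 0.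
    rewrite mulr_suml; under eq_bigr => x _ do rewrite -(Tone x).
    rewrite e1 -[RHS]u0; apply: eq_bigr => x _.
    by rewrite /one conjC1 mulr1.
  by move/eqP; rewrite mulf_eq0 conjC_eq0 (negPf a0) orbF => /eqP.
Qed.

Lemma cospectral_grid_ext_int (G : sgraph) (t1 t2 : nat) :
    (0 < t2)%N -> (t2 <= t1)%N -> cospectral G (clique_ext2 (grid t1 t2)) ->
  [/\ #|G| = (2 * (t1 * t2))%N,
      forall x : G, #|[set y | adj x y]|%:Z = 2 * (t1 + t2)%:Z - 3,
      forall u : G -> int,
        0 <= \sum_x \sum_y ((adj x y)%:Z + 3 * (x == y)%:Z) * (u x * u y)
    & forall Q : {set G},
        #|G|%:Z * \sum_(x in Q) #|[set y in Q | adj x y]|%:Z <=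
        (2 * (t1 + t2)%:Z - 3) * #|Q|%:Z ^+ 2 +
        (2 * t1%:Z - 3) * (#|G|%:Z * #|Q|%:Z - #|Q|%:Z ^+ 2)].
Proof.
move=> t20 t21 cGH; have [degG geG leG] := cospectral_grid_ext_forms t20 t21 cGH.
have t10 : (0 < t1)%N by apply: leq_trans t21.
have cG : #|G| = (2 * (t1 * t2))%N.
  by have [-> _ _] := cospectral_isometry cGH; rewrite card_grid_ext.
have conjz (z : int) : (z%:~R)^* = z%:~R :> algC by rewrite rmorph_int.
have sum_card (P : {pred G}) : \sum_x (x \in P)%:R = #|P|%:R :> algC.
  rewrite -sum1_card natr_sum [RHS]big_mkcond /=.
  by apply: eq_bigr => x _; case: (x \in P).
split=> //.
- move=> x; apply: (@intr_inj algC); rewrite rmorphB rmorphM /= -!pmulrn -(degG x).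
  by rewrite -sum_card; apply: eq_bigr => y _; rewrite inE.
- move=> u; rewrite -(ler_int algC).
  have := geG (fun x => (u x)%:~R); rewrite -[_ <= adjacency_form _ _]subr_ge0 mulNr opprK.
  suff <- : adjacency_form (fun x => (u x)%:~R) (fun x => (u x)%:~R) +
    3 * (\sum_x (u x)%:~R * ((u x)%:~R)^*) =
    (\sum_x \sum_y ((adj x y)%:Z + 3 * (x == y)%:Z) * (u x * u y))%:~R :> algC by [].
  rewrite /adjacency_form mulr_sumr -big_split raddf_sum; apply: eq_bigr => x _ /=.
  have -> : 3 * ((u x)%:~R * ((u x)%:~R)^*) =
     \sum_y 3 * (x == y)%:R * ((u x)%:~R * (u y)%:~R) :> algC.
    rewrite (bigD1 x) //= big1 ?addr0 => [|y /negPf yx].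
      by rewrite eqxx conjz mulr1.
    by rewrite eq_sym yx mulr0 mul0r.
  rewrite -big_split raddf_sum; apply: eq_bigr => y _.
  by rewrite /= conjz !rmorphM rmorphD rmorphM /= -!pmulrn; ring.
move=> Q; rewrite -(ler_int algC).
set n : algC := #|G|%:R; set q : algC := #|Q|%:R.
set k : algC := 2 * (t1 + t2)%:R - 3 in degG *.
have n0 : 0 < n by rewrite ltr0n cG !muln_gt0 t10 t20.
pose f x : algC := (x \in Q)%:R.
have sf : \sum_x f x = q by rewrite sum_card.
have sn (c : algC) : \sum_(x : G) c = n * c by rewrite sumr_const -mulr_natl.
(* The indicator of [Q] made orthogonal to constants, multiplied by [n] to avoid division. *)
pose u x := n * f x - q.
have conju x : (u x)^* = u x by rewrite /u rmorphB rmorphM /= !conjC_nat.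
have su : \sum_x u x = 0 by rewrite sumrB -mulr_sumr sf sn subrr.
have ff x : f x * f x = f x by rewrite /f; case: (x \in Q); rewrite ?mulr1 ?mulr0.
have := leG u su.
have -> : \sum_x u x * (u x)^* = n * (n * q - q ^+ 2).
  have uu x : u x * (u x)^* = (n ^+ 2 - 2 * n * q) * f x + q ^+ 2.
    rewrite conju [LHS](_ : _ = n ^+ 2 * (f x * f x) - 2 * n * q * f x + q ^+ 2).
      by rewrite ff; ring.
    by rewrite /u; ring.
  rewrite (eq_bigr _ (fun x _ => uu x)).
  by rewrite big_split /= -mulr_sumr sf sn; ring.
set e0 : int := \sum_(x in Q) _; pose e : algC := e0%:~R.
have -> : (#|G|%:Z * e0)%:~R = n * e by rewrite intrM -pmulrn.
have -> : ((2 * (t1 + t2)%:Z - 3) * #|Q|%:Z ^+ 2 +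
    (2 * t1%:Z - 3) * (#|G|%:Z * #|Q|%:Z - #|Q|%:Z ^+ 2))%:~R =
    k * q ^+ 2 + (2 * t1%:R - 3) * (n * q - q ^+ 2) :> algC.
  by rewrite /k /n /q natrD !pmulrn; ring.
have ee : \sum_x \sum_y (adj x y)%:R * f x * f y = e.
  rewrite /e raddf_sum [RHS]big_mkcond; apply: eq_bigr => x _; rewrite /f /=.
  case: (x \in Q) => /=; last by rewrite big1 // => y _; ring.
  rewrite -[RHS]pmulrn -[RHS]sum_card; apply: eq_bigr => y _; rewrite !inE.
  by case: (y \in Q); case: (adj x y) => /=; ring.
have -> : adjacency_form u u = n * (n * e - k * q ^+ 2).
  have e1 : \sum_x \sum_y (adj x y)%:R * f x = k * q.
    rewrite -sf mulr_sumr; apply: eq_bigr => x _.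
    by rewrite -mulr_suml degG.
  have e2 : \sum_x \sum_y (adj x y)%:R * f y = k * q.
    rewrite exchange_big -e1; apply: eq_bigr => x _; apply: eq_bigr => y _.
    by rewrite adj_sym.
  have e3 : \sum_(x : G) \sum_y (adj x y)%:R = n * k.
    by rewrite -sn; apply: eq_bigr => x _; rewrite degG.
  rewrite [RHS](_ : _ = n ^+ 2 * e - n * q * (k * q) - n * q * (k * q) +
    q ^+ 2 * (n * k)); last by ring.
  rewrite -ee -{1}e1 -e2 -e3 /adjacency_form !mulr_sumr -!sumrB -big_split /=.
  apply: eq_bigr => x _; rewrite !mulr_sumr -!sumrB -big_split /=.
  by apply: eq_bigr => y _; rewrite conju /u; ring.
rewrite [_ * (n * (n * q - _))]mulrCA ler_pM2l // => le_e.
by rewrite -lerBlDl.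
Qed.

(** * Cliques and Ramsey's theorem *)

Lemma card_bigcup_leq (I T : finType) (P : pred I) (F : I -> {set T}) :
  (#|\bigcup_(i | P i) F i| <= \sum_(i | P i) #|F i|)%N.
Proof.
elim/big_rec2: _ => [|i A n _ IH]; first by rewrite cards0.
exact: leq_trans (leq_card_setU _ _) (leq_add (leqnn _) IH).
Qed.

Section Cliques.
Variable G : sgraph.
Implicit Types (x y : G) (C D : {set G}).

Definition clique C := [forall x in C, forall y in C, (x != y) ==> adj x y].

Lemma cliqueP C :
  reflect {in C &, forall x y, x != y -> adj x y} (clique C).
Proof.
apply: (iffP forall_inP) => [H x y xC yC xy | H x xC].
  by have /forall_inP/(_ y yC)/implyP := H x xC; apply.
by apply/forall_inP => y yC; apply/implyP; apply: H.
Qed.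

Lemma subset_of_card (A : {set G}) k : (k <= #|A|)%N ->
  exists2 B : {set G}, B \subset A & #|B| = k.
Proof.
move=> kA; exists [set x in take k (enum A)].
  by apply/subsetP => x; rewrite inE => /mem_take; rewrite mem_enum.
rewrite cardsE; have /card_uniqP -> : uniq (take k (enum A)).
  by rewrite take_uniq ?enum_uniq.
by rewrite size_takel // -cardE.
Qed.

Definition coclique C := {in C &, forall x y, ~~ adj x y}.

End Cliques.

(** The bound is uniform in the graph. A vertex splits the rest of [S] into neighbours and
    non-neighbours, which gives the recursion [R (a+1) (b+1) <= R a (b+1) + R (a+1) b + 1]. *)
Lemma ramsey a b : exists R, forall (G : sgraph) (S : {set G}), (R <= #|S|)%N ->
  (exists C : {set G}, [/\ C \subset S, #|C| = a & clique C]) \/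
  (exists C : {set G}, [/\ C \subset S, #|C| = b & coclique C]).
Proof.
elim: a b => [|a IHa] b.
  exists 0 => G S _; left; exists set0; rewrite sub0set cards0; split=> //.
  by apply/cliqueP => x y; rewrite inE.
elim: b => [|b [R2 IHb]].
  exists 0 => G S _; right; exists set0; rewrite sub0set cards0; split=> //.
  by move=> x y; rewrite inE.
have [R1 {}IHa] := IHa b.+1; exists (R1 + R2).+1 => G S RS.
have [x xS] : exists x, x \in S.
  by apply/set0Pn; rewrite -card_gt0; apply: leq_trans RS.
pose S1 := [set y in S | adj x y]; pose S0 := [set y in S | ~~ adj x y] :\ x.
have S1x y : y \in S1 -> y \in S /\ adj x y by rewrite inE => /andP.
have S0x y : y \in S0 -> [/\ y != x, y \in S & ~~ adj x y].
  by rewrite !inE => /and3P[].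
have cS : (R1 + R2 <= #|S1| + #|S0|)%N.
  have : (#|S :\ x| <= #|S1| + #|S0|)%N.
    apply: leq_trans (leq_card_setU _ _); apply/subset_leq_card/subsetP => y.
    by rewrite !inE => /andP[-> ->]; case: (adj x y).
  by have := cardsD1 x S; rewrite xS; move: RS; lia.
have [/IHa|/IHb] : (R1 <= #|S1|)%N \/ (R2 <= #|S0|)%N by lia.
- case=> -[C [CS cC hC]].
    left; exists (x |: C); split.
    + by rewrite subUset sub1set xS; apply/subsetP => y /(subsetP CS)/S1x[].
    + rewrite cardsU1 cC (_ : x \notin C) //.
      by apply/negP => /(subsetP CS)/S1x[_]; rewrite adj_irr.
    apply/cliqueP => y z; rewrite !inE => /orP[/eqP->|yC] /orP[/eqP->|zC].
    + by rewrite eqxx.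
    + by have [_] := S1x _ (subsetP CS _ zC).
    + by rewrite adj_sym; have [_] := S1x _ (subsetP CS _ yC).
    + by move/cliqueP: hC; apply.
  right; exists C; split=> //.
  by apply/subsetP => y /(subsetP CS)/S1x[].
- case=> -[C [CS cC hC]].
    left; exists C; split=> //.
    by apply/subsetP => y /(subsetP CS)/S0x[].
  right; exists (x |: C); split.
  + by rewrite subUset sub1set xS; apply/subsetP => y /(subsetP CS)/S0x[].
  + rewrite cardsU1 cC (_ : x \notin C) //.
    by apply/negP => /(subsetP CS)/S0x[]; rewrite eqxx.
  move=> y z; rewrite !inE => /orP[/eqP->|yC] /orP[/eqP->|zC].
  + by rewrite adj_irr.
  + by have [] := S0x _ (subsetP CS _ zC).
  + by rewrite adj_sym; have [] := S0x _ (subsetP CS _ yC).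
  + exact: hC.
Qed.

(** * Quasi-cliques *)

Section Incidence.
Variables (G : sgraph) (F : finType) (inc : G -> F -> bool).

Definition common_fats x y := #|[set f | inc x f && inc y f]|.
(* [A + 3I - C C^T], the special matrix shifted by 3I. *)
Definition gram x y : int := (adj x y)%:Z + 3 * (x == y)%:Z - (common_fats x y)%:Z.

Lemma common_fatsC x y : common_fats x y = common_fats y x.
Proof. by apply: eq_card => f; rewrite !inE andbC. Qed.

Lemma gramC x y : gram x y = gram y x.
Proof.
rewrite /gram adj_sym eq_sym; congr (_ - Posz _).
by apply: eq_card => f; rewrite !inE andbC.
Qed.

End Incidence.

Lemma sum_posz (I : finType) (P : pred I) (f : I -> nat) :
  \sum_(i | P i) (f i)%:Z = (\sum_(i | P i) f i)%N%:Z.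
Proof. by rewrite -[RHS]natz natr_sum; apply: eq_bigr => i _; rewrite natz. Qed.

(** * Positivity of integral limits of Gram matrices *)

Section Gram.
Variable G : sgraph.
Implicit Types (u v : G -> int) (x y : G) (C D : {set G}).

Definition shifted_form u v : int :=
  \sum_x \sum_y ((adj x y)%:Z + 3 * (x == y)%:Z) * (u x * v y).

Hypothesis shifted_form_ge0 : forall u, 0 <= shifted_form u u.

Lemma shifted_formC u v : shifted_form u v = shifted_form v u.
Proof.
rewrite /shifted_form exchange_big; apply: eq_bigr => x _; apply: eq_bigr => y _.
by rewrite adj_sym eq_sym [u _ * _]mulrC.
Qed.

Lemma shifted_form_sum (I : finType) (a b : I -> int) (u v : I -> G -> int) :
  shifted_form (fun x => \sum_i a i * u i x) (fun x => \sum_j b j * v j x) =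
  \sum_i \sum_j a i * b j * shifted_form (u i) (v j).
Proof.
rewrite /shifted_form.
transitivity (\sum_x \sum_y \sum_i \sum_j a i * b j *
   (((adj x y)%:Z + 3 * (x == y)%:Z) * (u i x * v j y))).
  apply: eq_bigr => x _; apply: eq_bigr => y _.
  rewrite mulr_suml mulr_sumr; apply: eq_bigr => i _.
  by rewrite !mulr_sumr; apply: eq_bigr => j _; ring.
under eq_bigr => x _ do rewrite exchange_big.
rewrite exchange_big; apply: eq_bigr => i _.
under eq_bigr => x _ do rewrite exchange_big.
rewrite exchange_big; apply: eq_bigr => j _.
rewrite mulr_sumr; apply: eq_bigr => x _.
by rewrite mulr_sumr; apply: eq_bigr => y _.
Qed.

(** [z / N ^ 2] differs from [g] by at most [K / N], with denominators cleared to stay in the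
    integers. *)
Definition close (N K : nat) (z g : int) : bool :=
  `|z - N%:Z ^+ 2 * g| <= K%:Z * N%:Z.

(* An integer matrix that approximates [N^-2] times a Gram matrix of the
   positive semidefinite form [A + 3I] is itself nonnegative on small integer
   vectors, since the error stays below 1. *)
Lemma close_gram_ge0 (I : finType) (u : I -> G -> int) (g : I -> I -> int)
    (s : I -> int) (N K L : nat) :
    (forall i j, close N K (shifted_form (u i) (u j)) (g i j)) ->
    \sum_i `|s i| <= L%:Z -> (K * (L * L) < N)%N ->
  0 <= \sum_i \sum_j s i * s j * g i j.
Proof.
move=> cg sL KN; rewrite leNgt; apply/negP => X0.
have := shifted_form_ge0 (fun x => \sum_i s i * u i x).
rewrite shifted_form_sum.
set X := \sum_i _ in X0 *; set Y := \sum_i _.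
have : Y - N%:Z ^+ 2 * X <= K%:Z * N%:Z * ((\sum_i `|s i|) * \sum_j `|s j|).
  apply: le_trans (ler_norm _) _.
  rewrite /X /Y mulr_sumr -sumrB; apply: le_trans (ler_norm_sum _ _ _) _.
  rewrite mulr_suml mulr_sumr; apply: ler_sum => i _.
  rewrite mulr_sumr -sumrB; apply: le_trans (ler_norm_sum _ _ _) _.
  rewrite !mulr_sumr; apply: ler_sum => j _.
  rewrite (_ : _ - _ = s i * s j * (shifted_form (u i) (u j) - N%:Z ^+ 2 * g i j));
    last by ring.
  rewrite !normrM mulrC; apply: ler_wpM2r; rewrite ?mulr_ge0 ?normr_ge0 //.
  exact: cg.
move=> le1 ge0.
have S0 : 0 <= \sum_i `|s i| by rewrite sumr_ge0.
have le2 : K%:Z * N%:Z * ((\sum_i `|s i|) * \sum_i `|s i|) <= K%:Z * N%:Z * (L%:Z * L%:Z).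
  apply: ler_wpM2l; first by rewrite -PoszM.
  by apply: ler_pM.
have le3 : N%:Z ^+ 2 * X <= - N%:Z ^+ 2.
  rewrite -mulrN1; apply: ler_wpM2l; first by rewrite exprn_ge0.
  by move: X0; lia.
have : K%:Z * N%:Z * (L%:Z * L%:Z) < N%:Z ^+ 2.
  rewrite (_ : _ * _ = N%:Z * (K * (L * L))%N%:Z); last by rewrite !PoszM; ring.
  by rewrite expr2 ltr_pM2l ltz_nat //; apply: leq_ltn_trans KN.
move: ge0 le1 le2 le3.
set A := K%:Z * N%:Z * (L%:Z * _); set B := _ * (_ * _); set E := _ ^+ 2; set F := E * X.
by lia.
Qed.

(** The case of three vectors, stated as a refutation: a use supplies a limiting Gram matrix and
    coefficients at which it is negative. *)
Lemma close_gram3_lt0 (u1 u2 u3 : G -> int) (g11 g12 g13 g22 g23 g33 : int)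
    (s1 s2 s3 : int) (N K L : nat) :
    close N K (shifted_form u1 u1) g11 -> close N K (shifted_form u1 u2) g12 ->
    close N K (shifted_form u1 u3) g13 -> close N K (shifted_form u2 u2) g22 ->
    close N K (shifted_form u2 u3) g23 -> close N K (shifted_form u3 u3) g33 ->
    `|s1| + `|s2| + `|s3| <= L%:Z -> (K * (L * L) < N)%N ->
  s1 * s1 * g11 + s2 * s2 * g22 + s3 * s3 * g33 +
       2 * (s1 * s2 * g12 + s1 * s3 * g13 + s2 * s3 * g23) < 0 -> False.
Proof.
move=> c11 c12 c13 c22 c23 c33 sL KN; apply/negP; rewrite -leNgt.
pose u (i : 'I_3) := nth u1 [:: u1; u2; u3] i.
pose s (i : 'I_3) := nth 0 [:: s1; s2; s3] i.
pose g (i j : 'I_3) := nth 0 (nth [::] [:: [:: g11; g12; g13]; [:: g12; g22; g23];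
                                           [:: g13; g23; g33]] i) j.
have := @close_gram_ge0 _ u g s N K L.
rewrite !big_ord_recl !big_ord0 /u /s /g /= !addr0 addrA => H.
suff -> : s1 * s1 * g11 + s2 * s2 * g22 + s3 * s3 * g33 +
       2 * (s1 * s2 * g12 + s1 * s3 * g13 + s2 * s3 * g23) =
    s1 * s1 * g11 + (s1 * s2 * g12 + s1 * s3 * g13) +
    (s2 * s1 * g12 + (s2 * s2 * g22 + s2 * s3 * g23) +
     (s3 * s1 * g13 + (s3 * s2 * g23 + s3 * s3 * g33))) :> int.
  apply: H => //.
  by move=> [[|[|[|//]]] ?] [[|[|[|//]]] ?] //=; rewrite shifted_formC.
by ring.
Qed.

(** The factor [N] puts a vertex on the same scale as the indicator of an [N]-clique, so that all
    products are compared with [N ^ 2]. *)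
Definition point_vec (N : nat) x : G -> int := fun y => N%:Z * (y == x)%:Z.
Definition set_vec C : G -> int := fun y => (y \in C)%:Z.
Definition nbrs x C := #|[set y in C | adj x y]|.
Definition nonnbrs x C := #|[set y in C | ~~ adj x y]|.

Lemma nbrsDnonnbrs x C : (nbrs x C + nonnbrs x C)%N = #|C|.
Proof.
rewrite /nbrs /nonnbrs -(cardsID [set y | adj x y] C).
by congr (_ + _)%N; apply: eq_card => y; rewrite !inE andbC.
Qed.

Lemma nbrs_sub x C D : C \subset D -> (nbrs x C <= nbrs x D)%N.
Proof.
by move=> CD; apply/subset_leq_card/subsetP => y; rewrite !inE => /andP[/(subsetP CD)-> ->].
Qed.

Lemma nonnbrs_sub x C D : C \subset D -> (nonnbrs x C <= nonnbrs x D)%N.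
Proof.
by move=> CD; apply/subset_leq_card/subsetP => y; rewrite !inE => /andP[/(subsetP CD)-> ->].
Qed.

Lemma sum_mem_int (C : {pred G}) (f : G -> int) :
  \sum_y (y \in C)%:Z * f y = \sum_(y in C) f y.
Proof.
rewrite [RHS]big_mkcond /=; apply: eq_bigr => y _.
by case: (y \in C); rewrite ?mul1r ?mul0r.
Qed.

Lemma sum_pred1_int x (f : G -> int) : \sum_y (y == x)%:Z * f y = f x.
Proof.
rewrite (bigD1 x) //= big1 ?eqxx ?mul1r ?addr0 // => y /negPf->.
by rewrite mul0r.
Qed.

Lemma shifted_form_point N x v :
  shifted_form (point_vec N x) v =
  N%:Z * (\sum_y ((adj x y)%:Z + 3 * (x == y)%:Z) * v y).
Proof.
transitivity (\sum_z (z == x)%:Z *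
    \sum_y N%:Z * (((adj z y)%:Z + 3 * (z == y)%:Z) * v y)).
  apply: eq_bigr => z _; rewrite mulr_sumr; apply: eq_bigr => y _.
  by rewrite /point_vec; ring.
by rewrite sum_pred1_int mulr_sumr.
Qed.

Lemma shifted_form_points N x y :
  shifted_form (point_vec N x) (point_vec N y) =
  N%:Z ^+ 2 * ((adj x y)%:Z + 3 * (x == y)%:Z).
Proof.
rewrite shifted_form_point /point_vec expr2 -mulrA; congr (_ * _).
rewrite -(sum_pred1_int y (fun z => (adj x z)%:Z + 3 * (x == z)%:Z)) mulr_sumr.
by apply: eq_bigr => z _; ring.
Qed.

Lemma sum_shifted_row x C :
  \sum_y ((adj x y)%:Z + 3 * (x == y)%:Z) * set_vec C y =
  (nbrs x C)%:Z + 3 * (x \in C)%:Z.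
Proof.
rewrite /set_vec.
transitivity (\sum_y (y \in C)%:Z * (adj x y)%:Z + \sum_y (y == x)%:Z * (3 * (y \in C)%:Z)).
  by rewrite -big_split; apply: eq_bigr => y _; rewrite [x == y]eq_sym /=; ring.
rewrite sum_pred1_int; congr (_ + _).
rewrite sum_mem_int sum_posz /nbrs -sum1_card; congr Posz.
rewrite big_mkcond [RHS]big_mkcond /=; apply: eq_bigr => y _.
by rewrite inE; case: (y \in C); case: (adj x y).
Qed.

Lemma shifted_form_point_set N x C :
  shifted_form (point_vec N x) (set_vec C) = N%:Z * ((nbrs x C)%:Z + 3 * (x \in C)%:Z).
Proof. by rewrite shifted_form_point sum_shifted_row. Qed.

Lemma shifted_form_sets C D :
  shifted_form (set_vec C) (set_vec D) =
  \sum_(x in C) ((nbrs x D)%:Z + 3 * (x \in D)%:Z).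
Proof.
rewrite -sum_mem_int; apply: eq_bigr => x _.
rewrite -sum_shifted_row mulr_sumr; apply: eq_bigr => y _.
by rewrite /set_vec; ring.
Qed.

Lemma close_points N K x y :
  close N K (shifted_form (point_vec N x) (point_vec N y))
    ((adj x y)%:Z + 3 * (x == y)%:Z).
Proof. by rewrite /close shifted_form_points subrr normr0 -PoszM. Qed.

(** The number of neighbours in [C] misses [N] by at most [m]; the 3 pays for [x] lying in [C]. *)
Lemma close_point_set1 N K m x C : #|C| = N -> (nonnbrs x C <= m)%N -> (m + 3 <= K)%N ->
  close N K (shifted_form (point_vec N x) (set_vec C)) 1.
Proof.
move=> cC nx mK; rewrite /close shifted_form_point_set.
have := nbrsDnonnbrs x C; rewrite cC => eN.
rewrite mulr1 expr2 -mulrBr normrM [X in X <= _]mulrC ler_wpM2r //.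
by case: (x \in C) => /=; lia.
Qed.

Lemma close_point_set0 N K m x C : (nbrs x C <= m)%N -> (m + 3 <= K)%N ->
  close N K (shifted_form (point_vec N x) (set_vec C)) 0.
Proof.
move=> nx mK; rewrite /close shifted_form_point_set.
rewrite mulr0 subr0 normrM [X in X <= _]mulrC ler_wpM2r //.
by case: (x \in C) => /=; lia.
Qed.

(** An ordinary vertex of [C] contributes [N] up to [m + 3]; each of the at most [p] exceptional
    ones costs at most [N] more. *)
Lemma close_sets1 N K m p C D : #|C| = N -> #|D| = N ->
    (#|[set x in C | (m < nonnbrs x D)%N]| <= p)%N -> (p + m + 3 <= K)%N ->
  close N K (shifted_form (set_vec C) (set_vec D)) 1.
Proof.
move=> cC cD Cp pK; rewrite /close shifted_form_sets mulr1.
set B := [set x in C | _] in Cp.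
have -> : N%:Z ^+ 2 = \sum_(x in C) N%:Z by rewrite sumr_const cC -mulr_natr natz expr2.
rewrite -sumrB; apply: le_trans (ler_norm_sum _ _ _) _.
have le1 x : x \in C ->
    `|(nbrs x D)%:Z + 3 * (x \in D)%:Z - N%:Z| <= (m + 3)%:Z + N%:Z * (x \in B)%:Z.
  move=> xC; have := nbrsDnonnbrs x D; rewrite cD => eN.
  rewrite inE xC /=; case: (ltnP m _); case: (x \in D) => /= mx; lia.
apply: le_trans (ler_sum _ le1) _.
rewrite big_split /= sumr_const cC -mulr_sumr.
have -> : \sum_(x in C) (x \in B)%:Z = #|B|%:Z.
  rewrite sum_posz -sum1_card; congr Posz.
  rewrite big_mkcond [RHS]big_mkcond; apply: eq_bigr => x _ /=.
  by rewrite inE; case: (x \in C).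
rewrite -mulr_natr natz mulrC [_ * #|B|%:Z]mulrC.
rewrite [X in X + _]mulrC -mulrDl ler_wpM2r //; lia.
Qed.

Lemma close_sets0 N K m p C D : #|C| = N -> #|D| = N -> (p <= N)%N ->
    (#|[set x in C | (m < nbrs x D)%N]| <= p)%N -> (p + m + 6 <= K)%N ->
  close N K (shifted_form (set_vec C) (set_vec D)) 0.
Proof.
move=> cC cD pN Cp pK; rewrite /close shifted_form_sets mulr0 subr0.
set B := [set x in C | _] in Cp.
apply: le_trans (ler_norm_sum _ _ _) _.
have le1 x : x \in C ->
    `|(nbrs x D)%:Z + 3 * (x \in D)%:Z| <= (m + 3)%:Z + N%:Z * (x \in B)%:Z.
  move=> xC; have := nbrsDnonnbrs x D; rewrite cD => eN.
  rewrite inE xC /=; case: (ltnP m _); case: (x \in D) => /= mx; lia.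
apply: le_trans (ler_sum _ le1) _.
rewrite big_split /= sumr_const cC -mulr_sumr.
have -> : \sum_(x in C) (x \in B)%:Z = #|B|%:Z.
  rewrite sum_posz -sum1_card; congr Posz.
  rewrite big_mkcond [RHS]big_mkcond; apply: eq_bigr => x _ /=.
  by rewrite inE; case: (x \in C).
rewrite -mulr_natr natz mulrC [_ * #|B|%:Z]mulrC.
rewrite [X in X + _]mulrC -mulrDl ler_wpM2r //; lia.
Qed.


Lemma nonnbrs_clique C x : clique C -> x \in C -> (nonnbrs x C <= 1)%N.
Proof.
move=> /cliqueP cC xC; rewrite /nonnbrs -(cards1 x).
apply/subset_leq_card/subsetP => y; rewrite !inE => /andP[yC].
by apply: contraR => yx; apply: cC => //; rewrite eq_sym.
Qed.

Lemma close_cliques N K C D E : #|C| = N -> #|D| = N -> clique E ->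
  C \subset E -> D \subset E -> (4 <= K)%N ->
  close N K (shifted_form (set_vec C) (set_vec D)) 1.
Proof.
move=> cC cD cE CE DE K4; apply: (@close_sets1 N K 1 0) => //.
rewrite leqn0 cards_eq0; apply/eqP/setP => x; rewrite !inE.
apply/negP => /andP[xC]; rewrite ltnNge.
by rewrite (leq_trans (nonnbrs_sub x DE)) // nonnbrs_clique // (subsetP CE).
Qed.

(** * Classes of large cliques and their fat vertices *)

Variables m p N : nat.
(* Each bound is an instance of [K * L ^ 2 < N] in [close_gram_ge0]. *)
Hypotheses (m_large : (343 < m)%N) (p_large : (9 * (m + 6) < p)%N)
  (N_large : (144 * (p + m + 6) < N)%N).

(* Otherwise split C into large parts A, B with x adjacent to A only; the vector
   x - 3 (1_A - 1_B) / m has negative form. *)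
Lemma clique_dichotomy C x : clique C -> (nonnbrs x C <= m)%N \/ (nbrs x C <= m)%N.
Proof.
move=> cC; case: (leqP (nonnbrs x C) m) => [|nx]; [by left | right].
rewrite leqNgt; apply/negP => ax.
have [A /subsetP AC cA] := subset_of_card (ltnW ax).
have [B BC cB] : exists2 B : {set G}, B \subset [set y in C | ~~ adj x y] :\ x & #|B| = m.
  by apply: subset_of_card; have := cardsD1 x [set y in C | ~~ adj x y];
     move: nx; rewrite /nonnbrs; lia.
have {}BC y : y \in B -> [/\ y != x, y \in C & ~~ adj x y].
  by move=> /(subsetP BC); rewrite !inE => /and3P[].
have AC' : A \subset C by apply/subsetP => y /AC; rewrite inE => /andP[].
have BC' : B \subset C by apply/subsetP => y /BC[].
apply: (@close_gram3_lt0 (point_vec m x) (set_vec A) (set_vec B) 3 1 0 1 1 1 1 (-3) 3 m 7 7).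
- by have := close_points m 7 x x; rewrite adj_irr eqxx.
- apply: (@close_point_set1 m 7 0) => //; rewrite leqn0 cards_eq0.
  by apply/eqP/setP => y; rewrite !inE; apply/negP => /andP[/AC]; rewrite inE => /andP[_ ->].
- apply: (@close_point_set0 m 7 0) => //; rewrite leqn0 cards_eq0.
  by apply/eqP/setP => y; rewrite !inE; apply/negP => /andP[/BC[_ _ /negPf->]].
- exact: (close_cliques cA cA cC).
- exact: (close_cliques cA cB cC).
- exact: (close_cliques cB cB cC).
- by [].
- by move: m_large; lia.
- by [].
Qed.

Definition quasi C := [set x | (nonnbrs x C <= m)%N].

Lemma sub_quasi C : clique C -> C \subset quasi C.
Proof.
move=> cC; apply/subsetP => x xC; rewrite inE.
by apply: leq_trans (nonnbrs_clique cC xC) _; lia.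
Qed.

Lemma notin_quasi C x : clique C -> x \notin quasi C -> (nbrs x C <= m)%N.
Proof. by move=> cC; rewrite inE => nx; case: (clique_dichotomy x cC) => // h; rewrite h in nx. Qed.

(** Otherwise take [p]-subsets [C1] and [C0] of [C] inside and outside [quasi D], and a [p]-subset
    [E] of [D]. In the limit only [C0] and [E] are orthogonal, and [- C1 + C0 + E] has form 3 - 4 <
    0. *)
Lemma quasi_dichotomy C D : clique C -> clique D -> (p <= #|D|)%N ->
  (#|C :&: quasi D| <= p)%N \/ (#|C :\: quasi D| <= p)%N.
Proof.
move=> cC cD pD; case: (leqP #|C :\: quasi D| p) => [|p0]; [by right | left].
rewrite leqNgt; apply/negP => p1.
have [C1 C1s c1] := subset_of_card (ltnW p1).
have [C0 C0s c0] := subset_of_card (ltnW p0).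
have [E ED cE] := subset_of_card pD.
have C1C : C1 \subset C by apply: subset_trans C1s (subsetIl _ _).
have C0C : C0 \subset C by apply: subset_trans C0s (subsetDl _ _).
apply: (@close_gram3_lt0 (set_vec C1) (set_vec C0) (set_vec E) 1 1 1 1 0 1 (-1) 1 1 p (m + 6) 3).
- by apply: (close_cliques c1 c1 cC); rewrite // addnC.
- by apply: (close_cliques c1 c0 cC); rewrite // addnC.
- apply: (@close_sets1 p _ m 0) => //; last by rewrite leq_add2l.
  rewrite leqn0 cards_eq0; apply/eqP/setP => x; rewrite !inE.
  apply/negP => /andP[/(subsetP C1s)]; rewrite !inE => /andP[_ h].
  by rewrite ltnNge (leq_trans (nonnbrs_sub x ED)).
- by apply: (close_cliques c0 c0 cC); rewrite // addnC.
- apply: (@close_sets0 p _ m 0) => //.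
  rewrite leqn0 cards_eq0; apply/eqP/setP => x; rewrite !inE.
  apply/negP => /andP[/(subsetP C0s)]; rewrite inE => /andP[h _].
  by rewrite ltnNge (leq_trans (nbrs_sub x ED)) // notin_quasi.
- by apply: (close_cliques cE cE cD); rewrite // addnC.
- by [].
- by lia.
- by [].
Qed.

Definition Nclique C := (#|C| == N) && clique C.

(* With C and D almost the same clique, 2 (1_C - 1_D) / N is a near-null vector,
   so x cannot distinguish C from D. *)
Lemma quasi_sub C D : Nclique C -> Nclique D -> (#|C :\: quasi D| <= p)%N ->
  quasi D \subset quasi C.
Proof.
move=> /andP[/eqP cC C1] /andP[/eqP cD D1] CD; apply/subsetP => x xD.
apply/negPn/negP => /(notin_quasi C1) xC; rewrite inE in xD.
apply: (@close_gram3_lt0 (point_vec N x) (set_vec C) (set_vec D) 3 0 1 1 1 1 1 2 (-2)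
  N (p + m + 3) 5).
- by have := close_points N (p + m + 3) x x; rewrite adj_irr eqxx.
- by apply: (@close_point_set0 N _ m) => //; lia.
- by apply: (@close_point_set1 N _ m) => //; lia.
- by apply: (close_cliques cC cC C1) => //; lia.
- apply: (@close_sets1 N _ m p) => //.
  apply: leq_trans CD; apply/subset_leq_card/subsetP => y.
  by rewrite !inE -ltnNge => /andP[-> ->].
- by apply: (close_cliques cD cD D1) => //; lia.
- by [].
- by lia.
- by [].
Qed.

(** One inclusion gives the other: [D] lies in [quasi D], hence in [quasi C], so [quasi_sub] applies
    with the roles exchanged. *)
Lemma quasi_eq C D : Nclique C -> Nclique D -> (#|C :\: quasi D| <= p)%N ->
  quasi C = quasi D.
Proof.
move=> NC ND CD; have sDC := quasi_sub NC ND CD.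
apply/eqP; rewrite eqEsubset sDC andbT; apply: quasi_sub => //.
have /andP[_ D1] := ND.
by rewrite (eqP (_ : D :\: _ == set0)) ?cards0 // setD_eq0 (subset_trans (sub_quasi D1)).
Qed.

Lemma quasi_neq C D : Nclique C -> Nclique D -> quasi C != quasi D ->
  (#|C :&: quasi D| <= p)%N.
Proof.
move=> NC ND; have /andP[_ C1] := NC; have /andP[/eqP cD D1] := ND.
case: (quasi_dichotomy C1 D1); first by rewrite cD; lia.
  by [].
by move=> /(quasi_eq NC ND)->; rewrite eqxx.
Qed.

(** Naming a class of cliques by its vertex set identifies equivalent cliques without forming a
    quotient. *)
Definition fats : {set {set G}} := [set quasi C | C in Nclique].
Definition fat_type := {Q : {set G} | Q \in fats}.

Lemma fat_rep_sig (f : fat_type) : {C | Nclique C & val f = quasi C}.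
Proof. by have /imsetP/sig2_eqW[C] := valP f; exists C. Qed.
Definition fat_rep (f : fat_type) : {set G} := s2val (fat_rep_sig f).
Lemma fat_rep_Nclique f : Nclique (fat_rep f).
Proof. exact: (s2valP (fat_rep_sig f)). Qed.
Lemma fat_repE f : val f = quasi (fat_rep f).
Proof. exact: (s2valP' (fat_rep_sig f)). Qed.

Definition incident x (f : fat_type) : bool := x \in val f.

Lemma fat_has_slim f : exists x, incident x f.
Proof.
have /andP[/eqP cC C1] := fat_rep_Nclique f.
have [x xC] : exists x, x \in fat_rep f by apply/set0Pn; rewrite -card_gt0 cC; lia.
by exists x; rewrite /incident fat_repE (subsetP (sub_quasi C1)).
Qed.

(** In the limit distinct fat vertices are orthonormal and their products with vertices are the
    incidences. The bound 12 on the coefficients is the source of 144 in [N_large]. *)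
Lemma fat_gram_ge0 r (X : 'I_r -> G) (a : 'I_r -> int) (s : fat_type -> int) :
    \sum_i `|a i| + \sum_f `|s f| <= 12 ->
  0 <= \sum_i \sum_j a i * a j * ((adj (X i) (X j))%:Z + 3 * (X i == X j)%:Z)
       + 2 * (\sum_i \sum_f a i * s f * (incident (X i) f)%:Z)
       + \sum_f s f * s f.
Proof.
move=> as12.
pose u (i : ('I_r + fat_type)%type) :=
  match i with inl i => point_vec N (X i) | inr f => set_vec (fat_rep f) end.
pose g (i j : ('I_r + fat_type)%type) : int := match i, j with
  | inl i, inl j => (adj (X i) (X j))%:Z + 3 * (X i == X j)%:Z
  | inl i, inr f => (incident (X i) f)%:Z
  | inr f, inl i => (incident (X i) f)%:Z
  | inr f, inr f' => (f == f')%:Z end.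
pose t (i : ('I_r + fat_type)%type) := match i with inl i => a i | inr f => s f end.
have xf x f : close N (p + m + 6) (shifted_form (point_vec N x) (set_vec (fat_rep f)))
    (incident x f)%:Z.
  have /andP[/eqP cC C1] := fat_rep_Nclique f.
  rewrite /incident fat_repE; case: (boolP (x \in _)) => xC.
    by apply: (@close_point_set1 N _ m) => //; [move: xC; rewrite inE | lia].
  by apply: (@close_point_set0 N _ m); [exact: notin_quasi | lia].
have ff f f' : close N (p + m + 6)
    (shifted_form (set_vec (fat_rep f)) (set_vec (fat_rep f'))) (f == f')%:Z.
  have NC := fat_rep_Nclique f; have ND := fat_rep_Nclique f'.
  have /andP[/eqP cC C1] := NC; have /andP[/eqP cD D1] := ND.
  have [<-|nf] := eqVneq f f'; first by apply: (close_cliques cC cC C1) => //; lia.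
  have := quasi_neq NC ND; rewrite -!fat_repE (inj_eq val_inj) => /(_ nf) cCD.
  apply: (@close_sets0 N _ m p) => //; first by lia.
  apply: leq_trans cCD; apply/subset_leq_card/subsetP => x.
  rewrite in_setI [in X in X -> _]inE => /andP[-> h] /=.
  by rewrite fat_repE; apply/negPn/negP => /(notin_quasi D1); rewrite leqNgt h.
have : 0 <= \sum_i \sum_j t i * t j * g i j.
  apply: (@close_gram_ge0 _ u g t N (p + m + 6) 12); last by lia.
    by move=> [i|f] [j|f'] /=; rewrite ?close_points // shifted_formC.
  by rewrite big_sumType.
rewrite big_sumType /=.
under eq_bigr => i _ do rewrite big_sumType /=.
under [X in _ + X]eq_bigr => f _ do rewrite big_sumType /=.
rewrite !big_split /=.
suff e1 : \sum_f \sum_i s f * a i * (incident (X i) f)%:Z =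
          \sum_i \sum_f a i * s f * (incident (X i) f)%:Z.
  suff e2 : \sum_f \sum_f' s f * s f' * (f == f')%:Z = \sum_f s f * s f.
    by rewrite e1 e2; set A := \sum_i _; set B := \sum_i _; set C := \sum_f _; lia.
  apply: eq_bigr => f _; rewrite (bigD1 f) //= big1 ?eqxx ?mulr1 ?addr0 //.
  by move=> f' /negPf; rewrite eq_sym => ->; rewrite mulr0.
rewrite exchange_big; apply: eq_bigr => i _; apply: eq_bigr => f _.
by rewrite [s f * _]mulrC.
Qed.

(* The test vector is 3 x - 1_C, of form 27 - 60 + 30 < 0. *)
Lemma claw_free x C : C \subset [set y | adj x y] -> coclique C -> #|C| = 10%N -> False.
Proof.
move=> Cx cC c10.
have Cadj y : y \in C -> adj x y by move/(subsetP Cx); rewrite inE.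
have xC : x \notin C by apply/negP => /Cadj; rewrite adj_irr.
have nx : nbrs x C = 10%N.
  by rewrite -c10; apply: eq_card => y; rewrite inE; case: (boolP (y \in C)) => // /Cadj->.
have e12 : shifted_form (point_vec 1 x) (set_vec C) = 10.
  by rewrite shifted_form_point_set nx (negPf xC).
have e22 : shifted_form (set_vec C) (set_vec C) = 30.
  rewrite shifted_form_sets (eq_bigr (fun=> 3)) ?sumr_const ?c10 // => y yC.
  rewrite yC (_ : nbrs y C = 0%N) //; apply: eq_card0 => z.
  by rewrite inE; apply/negP => /andP[zC]; apply/negP/cC.
have e11 : shifted_form (point_vec 1 x) (point_vec 1 x) = 3.
  by rewrite shifted_form_points adj_irr eqxx.
apply: (@close_gram3_lt0 (point_vec 1 x) (set_vec C) (point_vec 1 x)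
  3 10 3 30 10 3 3 (-1) 0 1 0 4) => //; rewrite /close ?e11 ?e12 ?e22 //.
by rewrite shifted_formC e12.
Qed.

(** * Fat neighbours of a vertex and positivity of the shifted special matrix *)

Local Notation common := (common_fats incident).

Lemma card_incident x : common x x = #|[set f | incident x f]|.
Proof. by apply: eq_card => f; rewrite !inE andbb. Qed.

(** A vertex minus four of its fat neighbours would have form 3 - 8 + 4 = -1. *)
Lemma few_fats x : (common x x <= 3)%N.
Proof.
rewrite card_incident leqNgt; apply/negP => x4.
have [S Sx cS] : exists2 S : {set fat_type}, S \subset [set f | incident x f] & #|S| = 4%N.
  exists [set f in take 4 (enum [set f | incident x f])].
    by apply/subsetP => f; rewrite inE => /mem_take; rewrite mem_enum.
  rewrite cardsE; have /card_uniqP -> : uniq (take 4 (enum [set f | incident x f])).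
    by rewrite take_uniq ?enum_uniq.
  by rewrite size_takel // -cardE.
have cardS : \sum_f (f \in S)%:Z = 4.
  rewrite sum_posz; congr Posz; rewrite -[RHS]cS -sum1_card.
  by rewrite [RHS]big_mkcond; apply: eq_bigr => f _ /=; case: (f \in S).
have := @fat_gram_ge0 1 (fun=> x) (fun=> 1) (fun f => - (f \in S)%:Z).
rewrite !big_ord1 adj_irr eqxx.
have -> : \sum_f `|- (f \in S)%:Z| = 4 :> int.
  by rewrite -[RHS]cardS; apply: eq_bigr => f _; case: (f \in S).
have -> : \sum_f 1 * - (f \in S)%:Z * (incident x f)%:Z = - (4 : int).
  rewrite -[X in - X]cardS -sumrN; apply: eq_bigr => f _.
  case: (boolP (f \in S)) => [/(subsetP Sx)|]; last by rewrite mul1r mul0r.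
  by rewrite inE => ->.
have -> : \sum_f (- (f \in S)%:Z) * (- (f \in S)%:Z) = 4 :> int.
  by rewrite -[RHS]cardS; apply: eq_bigr => f _; case: (f \in S).
by move=> /(_ isT).
Qed.

Lemma common_sum x y : (common x y)%:Z = \sum_f (incident x f)%:Z * (incident y f)%:Z.
Proof.
rewrite /common_fats -sum1_card big_mkcond -sum_posz; apply: eq_bigr => f _.
by rewrite inE; case: (incident x f); case: (incident y f).
Qed.

(** Subtracting from the vertices their projections onto the fat vertices replaces [A + 3I] by
    [A + 3I - C C^T]. With at most three fat neighbours each, the coefficients total at most 3 + 9 =
    12. *)
Lemma gram_form_ge0 r (X : 'I_r -> G) (a : 'I_r -> int) : \sum_i `|a i| <= 3 ->
  0 <= \sum_i \sum_j a i * a j * gram incident (X i) (X j).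
Proof.
move=> a3; pose s f := - \sum_i a i * (incident (X i) f)%:Z.
have s9 : \sum_f `|s f| <= 9.
  have le1 : \sum_f `|s f| <= \sum_f \sum_i `|a i| * (incident (X i) f)%:Z.
    apply: ler_sum => f _; rewrite normrN; apply: le_trans (ler_norm_sum _ _ _) _.
    by apply: ler_sum => i _; rewrite normrM.
  apply: le_trans le1 _; rewrite exchange_big /=.
  have le2 : \sum_i \sum_f `|a i| * (incident (X i) f)%:Z <= \sum_i `|a i| * 3.
    apply: ler_sum => i _; rewrite -mulr_sumr; apply: ler_wpM2l => //.
    rewrite (_ : \sum_f _ = (common (X i) (X i))%:Z) ?lez_nat ?few_fats //.
    by rewrite common_sum; apply: eq_bigr => f _; case: (incident _ f).
  by apply: le_trans le2 _; rewrite -mulr_suml; exact: (ler_wpM2r (isT : 0 <= 3 :> int) a3).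
have := @fat_gram_ge0 r X a s.
have -> : \sum_f s f * s f = - \sum_i \sum_f a i * s f * (incident (X i) f)%:Z.
  rewrite exchange_big -sumrN; apply: eq_bigr => f _ /=.
  rewrite {1}/s mulNr mulr_suml; congr (- _); apply: eq_bigr => i _; ring.
have -> : \sum_i \sum_j a i * a j * gram incident (X i) (X j) =
   \sum_i \sum_j a i * a j * ((adj (X i) (X j))%:Z + 3 * (X i == X j)%:Z)
   + \sum_i \sum_f a i * s f * (incident (X i) f)%:Z.
  rewrite -big_split; apply: eq_bigr => i _ /=.
  have -> : \sum_f a i * s f * (incident (X i) f)%:Z =
      - \sum_j a i * a j * (common (X i) (X j))%:Z.
    under [in RHS]eq_bigr => j _ do rewrite common_sum mulr_sumr.
    rewrite exchange_big -sumrN; apply: eq_bigr => f _ /=.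
    rewrite /s mulrN mulNr mulr_sumr mulr_suml; congr (- _).
    by apply: eq_bigr => j _; ring.
  by rewrite -sumrB; apply: eq_bigr => j _; rewrite /gram; ring.
set A := \sum_i \sum_j _; set B := \sum_i \sum_f _.
have as12 : \sum_i `|a i| + \sum_f `|s f| <= 12 by exact: (lerD a3 s9).
by move=> /(_ as12); rewrite mulr_natl mulr2n addrA addrK.
Qed.

(** * Two fat neighbours at every vertex *)

Variables R t1 t2 : nat.
Hypothesis ramseyR : forall S : {set G}, (R <= #|S|)%N ->
  (exists C : {set G}, [/\ C \subset S, #|C| = N & clique C]) \/
  (exists C : {set G}, [/\ C \subset S, #|C| = 10%N & coclique C]).

(** Among [R] non-neighbours of [x] in [quasi C], an [N]-clique would define the same class, which
    contains [x], although [x] is adjacent to none of it. Ten pairwise non-adjacent vertices miss at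
    most [10 * m] vertices of [C], so they have a common neighbour in [C] and form a claw. *)
Lemma nonnbrs_quasi C x : Nclique C -> x \in quasi C -> (nonnbrs x (quasi C) < R)%N.
Proof.
move=> NC xC; have /andP[/eqP cC C1] := NC.
rewrite ltnNge; apply/negP => /ramseyR[] [D [DS cD hD]].
  have ND : Nclique D by rewrite /Nclique cD eqxx.
  have DC : D \subset quasi C.
    by apply/subsetP => y /(subsetP DS); rewrite inE => /andP[].
  have eDC : quasi D = quasi C.
    by apply: quasi_eq => //; rewrite (eqP (_ : D :\: _ == set0)) ?cards0 // setD_eq0.
  move: xC; rewrite -eDC inE (_ : nonnbrs x D = N); first by lia.
  rewrite -cD; apply: eq_card => y; rewrite inE; case: (boolP (y \in D)) => // yD.
  by have := subsetP DS _ yD; rewrite inE => /andP[].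
have Dm y : y \in D -> (nonnbrs y C <= m)%N.
  by move/(subsetP DS); rewrite !inE => /andP[].
pose B := \bigcup_(y in D) [set z in C | ~~ adj y z].
have cB : (#|B| <= 10 * m)%N.
  have le1 : (#|B| <= \sum_(y in D) nonnbrs y C)%N by apply: card_bigcup_leq.
  apply: leq_trans le1 _; rewrite -cD -sum_nat_const.
  exact: leq_sum.
have [c] : exists c, c \in C :\: B.
  apply/set0Pn; rewrite -card_gt0; have := cardsID B C.
  have : (#|C :&: B| <= #|B|)%N by apply/subset_leq_card/subsetIr.
  by lia.
rewrite inE => /andP[cnB cinC]; apply: (@claw_free c D) => //.
apply/subsetP => y yD; rewrite inE adj_sym; apply: contraNT cnB => yc.
by apply/bigcupP; exists y; rewrite // inE cinC.
Qed.

Hypotheses (t2_le_t1 : (t2 <= t1)%N) (R_t2 : (R + 3 <= t2)%N).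
Hypothesis card_vertices : #|G| = (2 * (t1 * t2))%N.
Hypothesis regular : forall x, #|[set y | adj x y]|%:Z = 2 * (t1 + t2)%:Z - 3.
Hypothesis second_eigenvalue : forall Q : {set G},
  #|G|%:Z * \sum_(x in Q) (nbrs x Q)%:Z <=
  (2 * (t1 + t2)%:Z - 3) * #|Q|%:Z ^+ 2 +
  (2 * t1%:Z - 3) * (#|G|%:Z * #|Q|%:Z - #|Q|%:Z ^+ 2).

(** Inner degrees in [Q] exceed [q - R], while the second eigenvalue limits the average inner
    degree. After division by [2 * t2] this reads [t1 * (q - R - 2 * t1 + 3) <= q], which fails for
    large [q]. *)
Lemma small_quasi C : Nclique C -> (#|quasi C| + R)%:Z <= 2 * (t1 + t2)%:Z - 3.
Proof.
move=> NC; rewrite leNgt; apply/negP => large.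
set Q := quasi C in large; set q := #|Q| in large.
have le1 : q%:Z * (q%:Z - R%:Z) <= \sum_(x in Q) (nbrs x Q)%:Z.
  rewrite mulrC -[q%:Z]natz mulr_natr -sumr_const; apply: ler_sum => x xQ.
  by have := nbrsDnonnbrs x Q; have := nonnbrs_quasi NC xQ; rewrite -/Q -/q; lia.
have le2 := le_trans (ler_wpM2l (isT : 0 <= #|G|%:Z) le1) (second_eigenvalue Q).
have q0 : 0 < q%:Z by move: large; lia.
have : #|G|%:Z * (q%:Z - R%:Z) <=
  (2 * (t1 + t2)%:Z - 3) * q%:Z + (2 * t1%:Z - 3) * (#|G|%:Z - q%:Z).
  rewrite -(ler_pM2l q0); move: le2; rewrite -/q.
  set n := #|G|%:Z; set T := (t1 + t2)%:Z => le2.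
  by rewrite mulrCA; apply: le_trans le2 _; rewrite le_eqVlt; apply/orP; left; apply/eqP; ring.
rewrite card_vertices => le3.
have le4 : t1%:Z * (q%:Z - R%:Z - 2 * t1%:Z + 3) <= q%:Z.
  have t20 : 0 < 2 * t2%:Z :> int by move: R_t2; lia.
  rewrite -(ler_pM2l t20); move: le3; rewrite !PoszM PoszD => le3.
  rewrite -subr_ge0; rewrite -subr_ge0 in le3.
  by rewrite [X in 0 <= X](_ : _ = (2 * (t1%:Z + t2%:Z) - 3) * q%:Z +
    (2 * t1%:Z - 3) * (2 * (t1%:Z * t2%:Z) - q%:Z) -
    2 * (t1%:Z * t2%:Z) * (q%:Z - R%:Z)); last by ring.
(* [b] and [c] are the slacks in [R_t2] and in the assumed lower bound on [q]. In these terms the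
   left side of [le4] contains [7 * t1], which beats [2 * (t1 + t2)]. *)
pose b := t2%:Z - (R%:Z + 3); pose c := q%:Z - (2 * (t1%:Z + t2%:Z) - 2 - R%:Z).
have t1b : 0 <= t1%:Z * b by rewrite mulr_ge0 // /b; move: R_t2; lia.
have t1c : 0 <= (t1%:Z - 1) * c.
  by apply: mulr_ge0; rewrite /c; move: R_t2 t2_le_t1 large; lia.
have e4 : t1%:Z * (q%:Z - R%:Z - 2 * t1%:Z + 3) =
    7 * t1%:Z + 2 * (t1%:Z * b) + (t1%:Z - 1) * c + c by rewrite /b /c; ring.
move: le4; rewrite e4; move: t1b t1c; set B := _ * b; set D := _ * c.
by rewrite /c; move: R_t2 t2_le_t1; lia.
Qed.

Lemma clique_in_nbrs x (S : {set G}) : S \subset [set y | adj x y] -> (R <= #|S|)%N ->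
  exists C : {set G}, [/\ C \subset S, Nclique C & x \in quasi C].
Proof.
move=> Sx /ramseyR[] [C [CS cC hC]]; last first.
  by case: (@claw_free x C) => //; apply: subset_trans Sx.
exists C; split=> //; first by rewrite /Nclique cC eqxx.
rewrite inE (_ : nonnbrs x C = 0%N) //; apply: eq_card0 => y; rewrite inE.
by apply/negP => /andP[/(subsetP CS)/(subsetP Sx)]; rewrite inE => ->.
Qed.

Lemma two_fats x : (1 < common x x)%N.
Proof.
have [||C [Cx NC xC]] := @clique_in_nbrs x [set y | adj x y]; first by [].
  by have := regular x; move: R_t2; lia.
(* By [small_quasi] at least [R] neighbours of [x] lie outside [quasi C]. A clique found among them
   has another class, because it avoids [quasi C]. *)
have [||D [DS ND xD]] := @clique_in_nbrs x ([set y | adj x y] :\: quasi C).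
- exact: subsetDl.
- have := cardsID (quasi C) [set y | adj x y].
  have : (#|[set y | adj x y] :&: quasi C| <= #|quasi C|)%N.
    exact/subset_leq_card/subsetIr.
  by have := small_quasi NC; have := regular x; lia.
have fC : quasi C \in fats by apply: imset_f.
have fD : quasi D \in fats by apply: imset_f.
have CD : quasi C != quasi D.
  have /andP[/eqP cD D1] := ND.
  have [y yD] : exists y, y \in D by apply/set0Pn; rewrite -card_gt0 cD; lia.
  apply/eqP => e; have := subsetP DS y yD.
  by rewrite inE e (subsetP (sub_quasi D1) y yD).
rewrite card_incident.
pose f1 : fat_type := Sub (quasi C) fC; pose f2 : fat_type := Sub (quasi D) fD.
rewrite -(_ : #|[set f1; f2]| = 2%N); last by rewrite cards2 -val_eqE /= CD.
apply/subset_leq_card/subsetP => f; rewrite !inE.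
by case/orP => /eqP->.
Qed.

End Gram.

(** * Line Hoffman graphs *)

Lemma special_entryE (h : hoffman) (x y : slim_graph h) :
  special_entry x y = (adj (val x) (val y))%:Z -
    #|[set f in fat_set h | adj (val x) f && adj (val y) f]|%:Z.
Proof.
rewrite /special_entry /special_mx !mxE !enum_rankK; congr (_ - _); first by rewrite natz.
under eq_bigr => j _ do rewrite !mxE !enum_rankK.
rewrite -(big_enum_val (fun f => (adj (val x) f)%:R * (adj (val y) f)%:R)).
rewrite -sum1_card -sum_posz big_mkcond [RHS]big_mkcond; apply: eq_bigr => f _ /=.
rewrite !inE; case: (fat f) => //=.
by case: (adj _ f); case: (adj _ f).
Qed.

(** A generated subgraph keeps all fat neighbours of its slim vertices, so common fat neighbours are
    counted alike. *)
Lemma special_entry_generated (h : hoffman) (W : {set slim_graph h})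
    (x y : slim_graph h) (u v : slim_graph (generated_hoffman W)) :
  val x = val (val u) -> val y = val (val v) -> special_entry x y = special_entry u v.
Proof.
move=> xu yv; rewrite !special_entryE xu yv; congr (_ - Posz _).
have xW : x \in W.
  have := valP (val u); rewrite !inE -xu => /orP[/imsetP[w wW /val_inj->//]|].
  by case/andP => fx _; have := valP x; rewrite inE fx.
rewrite -(card_imset _ val_inj); apply: eq_card => f; apply/idP/imsetP.
  rewrite !inE => /andP[ff /andP[uf vf]].
  have fW : f \in generated_set W.
    rewrite !inE ff; apply/orP; right; apply/existsP; exists x.
    by rewrite xW xu.
  exists (Sub f fW); rewrite // !inE; apply/and3P; split=> //.
by case=> g; rewrite !inE => /andP[fg /andP[ug vg]] ->; apply/and3P.
Qed.

Lemma hoffman_embedding (h k : hoffman) (f : h -> k) : injective f ->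
    (forall x y, adj (f x) (f y) = adj x y) -> (forall x, fat (f x) = fat x) ->
  exists (U : {set k}) (hU : hoffman_set U), hoffman_isomorphic h (induced_hoffman hU).
Proof.
move=> f_inj f_adj f_fat; pose U := [set f x | x : h].
have fU x : f x \in U by apply: imset_f.
have hU : hoffman_set U.
  move=> _ /imsetP[x _ ->]; rewrite f_fat => /fat_slim[y sy xy].
  by exists (f y); rewrite fU f_fat f_adj.
exists U, hU, (fun x => Sub (f x) (fU x) : induced_hoffman hU); last by move=> x; apply: f_fat.
split; last by move=> x y; apply: f_adj.
apply: inj_card_bij; first by move=> x y /(congr1 val) /= /f_inj.
have cU : (#|U| <= #|h|)%N by apply: leq_imset_card.
by apply: leq_trans cU; rewrite card_sig; apply/subset_leq_card/subsetP => y; rewrite inE.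
Qed.

(** * Decomposition along the nonzero entries of the shifted special matrix *)

Section BuildLine.
Variables (G : sgraph) (F : finType) (inc : G -> F -> bool).
Local Notation com := (common_fats inc).
Local Notation T := (gram inc).
Hypothesis inc_slim : forall f, exists x, inc x f.

(** The equality clause gives vertices with three fat neighbours, where [T x x = 0], a piece of
    their own. *)
Definition same_piece : rel G := fun x y => (x == y) || (T x y != 0).

(** On a piece with several vertices these hypotheses make [T] equal to [v v^T] for a vector [v] of
    signs; [negative_partner] says that both signs occur. *)
Hypothesis gram_mul : forall x y z, T x y != 0 -> T y z != 0 ->
  T x z = T x y * T y z.
Hypothesis gram_le1 : forall x y, `|T x y| <= 1.
Hypothesis two_le_fats : forall x, (1 < com x x)%N.
Hypothesis fats_le_three : forall x, (com x x <= 3)%N.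
Hypothesis negative_partner : forall x y, x != y -> T x y != 0 ->
  exists z, T x z = -1.

Lemma same_piece_equiv : equivalence_rel same_piece.
Proof.
have sym x y : same_piece x y = same_piece y x by rewrite /same_piece eq_sym gramC.
have trans x y z : same_piece x y -> same_piece y z -> same_piece x z.
  rewrite /same_piece => /orP[/eqP->//|xy] /orP[/eqP<-|yz]; first by rewrite xy orbT.
  by rewrite (gram_mul xy yz) mulf_neq0 ?orbT.
move=> x y z; split=> [|xy]; first by rewrite /same_piece eqxx.
by apply/idP/idP; apply: trans; rewrite // sym.
Qed.

Definition line : hoffman := build_hoffman (@adj_sym G) (@adj_irr G) inc_slim.

Lemma slim_inl x : (inl x : line) \in slim_set line. Proof. by rewrite inE. Qed.
Definition to_slim x : slim_graph line := Sub (inl x : line) (slim_inl x).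

Lemma to_slim_onto (s : slim_graph line) : exists x, s = to_slim x.
Proof.
case: s => -[x|f] sx; first by exists x; apply: val_inj.
by exfalso; move: sx; rewrite inE.
Qed.

Lemma card_line_fats (P : pred F) :
  #|[set f in fat_set line | if f is inr g then P g else false]| = #|[set f | P f]|.
Proof.
rewrite -[RHS](card_imset _ (@inr_inj G F)); apply: eq_card => -[x|f]; rewrite !inE.
  by apply/esym/negP => /imsetP[g _].
apply/idP/imsetP => [Pf|[g gP [->]]]; first by exists f; rewrite ?inE.
by move: gP; rewrite inE.
Qed.

Lemma special_entry_line x y :
  special_entry (to_slim x) (to_slim y) = T x y - 3 * (x == y)%:Z.
Proof.
rewrite special_entryE /= /gram addrAC addrK /common_fats; congr (_ - Posz _).
rewrite -card_line_fats; apply: eq_card => -[z|f]; by rewrite !inE.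
Qed.

Lemma line_t_fat : t_fat 2 line.
Proof.
move=> [x|//] _; apply: leq_trans (two_le_fats x) _.
rewrite /common_fats -card_line_fats; apply: subset_leq_card.
by apply/subsetP => -[z|f]; rewrite !inE ?andbF //= andbb.
Qed.

Lemma line_slim_graph : sgraph_isomorphic G (slim_graph line).
Proof.
exists to_slim; split; last by [].
apply: inj_card_bij; first by move=> x y /(congr1 val) [].
apply: leq_trans (_ : #|[set to_slim x | x : G]| <= _)%N; last exact: leq_imset_card.
apply/subset_leq_card/subsetP => s _.
by have [x ->] := to_slim_onto s; apply: imset_f.
Qed.

(* The value on fat vertices is irrelevant: they do not occur in [slim_graph]. *)
Definition slim_piece : rel (slim_graph line) := fun s s' =>
  match val s, val s' with inl x, inl y => same_piece x y | _, _ => false end.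

Definition piece x : {set slim_graph line} := [set s | slim_piece (to_slim x) s].

Lemma to_slim_piece x y : (to_slim y \in piece x) = same_piece x y.
Proof. by rewrite inE. Qed.

Definition pieces : {set {set slim_graph line}} := equivalence_partition slim_piece setT.

Lemma piecesP W : W \in pieces -> exists x, W = piece x.
Proof.
case/imsetP => s _ ->; have [x ->] := to_slim_onto s; exists x.
by apply/setP => s'; rewrite !inE.
Qed.

Lemma pieces_decomposition : decomposition pieces.
Proof.
split.
- apply: equivalence_partitionP => s1 s2 s3 _ _ _.
  have [x1 ->] := to_slim_onto s1; have [x2 ->] := to_slim_onto s2.
  have [x3 ->] := to_slim_onto s3; exact: same_piece_equiv.
- by move=> W _ x y u v; apply: special_entry_generated.
move=> W1 W2 /piecesP[x1 ->] /piecesP[x2 ->] W12 s1 s2.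
have [y1 ->] := to_slim_onto s1; have [y2 ->] := to_slim_onto s2.
rewrite !to_slim_piece special_entry_line => p1 p2.
have np : ~~ same_piece y1 y2.
  apply: contra W12 => p12; apply/eqP/setP => s; have [y ->] := to_slim_onto s.
  have [_ eq1] := same_piece_equiv x1 y1 y; have [_ eq2] := same_piece_equiv y1 y2 y.
  have [_ eq3] := same_piece_equiv x2 y2 y.
  by rewrite !to_slim_piece eq1 // eq2 // eq3.
by move: np; rewrite negb_or negbK => /andP[/negPf-> /eqP->].
Qed.

Lemma gram_diag x : T x x = 3 - (com x x)%:Z.
Proof. by rewrite /gram adj_irr eqxx. Qed.

Lemma gram_offdiag x y : x != y -> T x y = (adj x y)%:Z - (com x y)%:Z.
Proof. by move=> /negPf xy; rewrite /gram xy addr0. Qed.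

Lemma common_fats_uniq x y f g : com x y = 1%N ->
  inc x f -> inc y f -> inc x g -> inc y g -> f = g.
Proof.
move=> xy; have /card_le1_eqP H : (com x y <= 1)%N by rewrite xy.
by move=> xf yf xg yg; apply: H; rewrite inE ?xf ?xg.
Qed.

Lemma uncommon_fats_uniq x y f g : com x x = 2%N -> com x y = 1%N ->
  inc x f -> ~~ inc y f -> inc x g -> ~~ inc y g -> f = g.
Proof.
move=> xx xy; have c1 : (#|[set f | inc x f] :\: [set f | inc y f]| <= 1)%N.
  have := cardsID [set f | inc y f] [set f | inc x f].
  rewrite (_ : #|_ :&: _| = 1%N); last by rewrite -xy; apply: eq_card => h; rewrite !inE.
  rewrite (_ : #|[set f | inc x f]| = 2%N); first by lia.
  by rewrite -xx; apply: eq_card => h; rewrite !inE andbb.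
move: c1 => /card_le1_eqP H xf yf xg yg.
by apply: H; rewrite !inE ?xf ?xg ?yf ?yg.
Qed.

Lemma common_fat_exists x y : com x y = 1%N -> exists2 f, inc x f & inc y f.
Proof.
move=> xy; have : (0 < com x y)%N by rewrite xy.
by rewrite card_gt0 => /set0Pn[f]; rewrite inE => /andP[]; exists f.
Qed.

Lemma common_fats0 x y f : com x y = 0%N -> inc x f -> inc y f = false.
Proof.
move/eqP; rewrite cards_eq0 => /eqP/setP/(_ f); rewrite !inE => + xf.
by rewrite xf.
Qed.

(** The fat vertices that [w] shares with the three others would be distinct, but [w] has only
    two. *)
Lemma no_three_disjoint w y1 y2 y3 : com w w = 2%N ->
    com w y1 = 1%N -> com w y2 = 1%N -> com w y3 = 1%N ->
    com y1 y2 = 0%N -> com y1 y3 = 0%N -> com y2 y3 = 0%N ->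
  False.
Proof.
move=> ww /common_fat_exists[f1 w1 i1] /common_fat_exists[f2 w2 i2].
move=> /common_fat_exists[f3 w3 i3] y12 y13 y23.
have n12 : f1 != f2 by apply: contraTneq i1 => ->; rewrite common_fatsC in y12; rewrite (common_fats0 y12).
have n13 : f1 != f3 by apply: contraTneq i1 => ->; rewrite common_fatsC in y13; rewrite (common_fats0 y13).
have n23 : f2 != f3 by apply: contraTneq i2 => ->; rewrite common_fatsC in y23; rewrite (common_fats0 y23).
have : (#|[set f1; f2; f3]| <= com w w)%N.
  apply/subset_leq_card/subsetP => f; rewrite !inE => /orP[/orP[]|] /eqP->;
  by rewrite ?w1 ?w2 ?w3.
by rewrite ww -setUA cardsU1 cards2 !inE negb_or n12 n13 n23.
Qed.

Lemma negative_neq y w : T y w = -1 -> y != w.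
Proof.
move=> yw; apply: contra_eq_neq yw => ->.
by rewrite gram_diag; have := fats_le_three w; lia.
Qed.

Lemma positive_pair y w : y != w -> T y w = 1 -> adj y w /\ com y w = 0%N.
Proof. by move=> /gram_offdiag->; case: (adj y w) => /=; lia. Qed.

(** * Pieces with a negative entry *)

Section NegativePair.
Variables x z : G.
Hypothesis gram_xz : T x z = -1.

(** The negative entry forces [T x x = 1], which covers the case [y = x]. *)
Lemma gram_class y : same_piece x y -> T x y != 0.
Proof.
case/orP => [/eqP<-|//].
have xz0 : T x z != 0 by rewrite gram_xz.
have zx0 : T z x != 0 by rewrite gramC gram_xz.
by rewrite (gram_mul xz0 zx0) [T z x]gramC gram_xz.
Qed.

Lemma gram_class_prod y w : same_piece x y -> same_piece x w ->
  T y w = T x y * T x w.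
Proof.
move=> /gram_class xy /gram_class xw; rewrite [T x y]gramC; apply: gram_mul => //.
by rewrite gramC.
Qed.

Lemma gram_class_sign y : same_piece x y -> T x y = 1 \/ T x y = -1.
Proof. by move=> /gram_class; have := gram_le1 x y; lia. Qed.

Lemma class_two_fats y : same_piece x y -> com y y = 2%N.
Proof.
move=> xy; have := gram_diag y; rewrite (gram_class_prod xy xy).
by case: (gram_class_sign xy) => ->; lia.
Qed.

Lemma class_x : same_piece x x. Proof. by rewrite /same_piece eqxx. Qed.
Lemma class_z : same_piece x z. Proof. by rewrite /same_piece gram_xz orbT. Qed.

(** Adjacent [y] and [w] with entry -1 share both of their fat neighbours. For any other [v] the
    entries at [y] and [w] are opposite signs, so they differ by 2, yet with equal fat counts they
    can differ only by an adjacency. *)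
Lemma adjacent_negative_pair y w v : same_piece x y -> same_piece x w ->
  T y w = -1 -> adj y w -> same_piece x v -> v = y \/ v = w.
Proof.
move=> xy xw yw ayw xv.
have cyw : com y w = 2%N.
  by have := gram_offdiag (negative_neq yw); rewrite yw ayw; lia.
have inc_yw f : inc y f = inc w f.
  have e (u : G) : com u u = 2%N -> [set f | inc y f && inc w f] \subset [set f | inc u f] ->
      [set f | inc y f && inc w f] = [set f | inc u f].
    move=> uu sub; apply/eqP; rewrite eqEcard sub /=.
    rewrite -/(com y w) cyw -uu; apply/subset_leq_card/subsetP => h.
    by rewrite !inE => ->.
  have e1 : [set f | inc y f] = [set f | inc w f].
    rewrite -(e y (class_two_fats xy)); last by apply/subsetP => h; rewrite !inE => /andP[].
    by apply: e (class_two_fats xw) _; apply/subsetP => h; rewrite !inE => /andP[].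
  by move/setP/(_ f): e1; rewrite !inE.
have [->|vy] := eqVneq v y; first by left.
have [->|vw] := eqVneq v w; first by right.
have cc : com v y = com v w.
  by apply: eq_card => f; rewrite !inE inc_yw.
have := gram_offdiag vy; have := gram_offdiag vw; rewrite cc.
rewrite (gram_class_prod xv xw) (gram_class_prod xv xy).
move: yw; rewrite (gram_class_prod xy xw).
case: (gram_class_sign xy) => ->; case: (gram_class_sign xw) => ->;
case: (gram_class_sign xv) => ->; case: (adj v w); case: (adj v y) => /=; lia.
Qed.

End NegativePair.

(** * Embedding the pieces into the three Hoffman graphs *)

Definition piece_fat x f := exists2 y, same_piece x y & inc y f.

(** The maps are total on [G] and [F] but constrained only on the piece, which keeps subtypes out of
    the three cases. *)
Lemma piece_embedding x (S F' : finType) (a : rel S) (c : S -> F' -> bool)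
    (a_sym : symmetric a) (a_irr : irreflexive a) (c_slim : forall f, exists s, c s f)
    (al : G -> S) (be : F -> F') :
    (forall y w, same_piece x y -> same_piece x w -> al y = al w -> y = w) ->
    (forall f g, piece_fat x f -> piece_fat x g -> be f = be g -> f = g) ->
    (forall y w, same_piece x y -> same_piece x w -> a (al y) (al w) = adj y w) ->
    (forall y f, same_piece x y -> piece_fat x f -> c (al y) (be f) = inc y f) ->
  exists (U : {set build_hoffman a_sym a_irr c_slim}) (hU : hoffman_set U),
    hoffman_isomorphic (generated_hoffman (piece x)) (induced_hoffman hU).
Proof.
move=> al_inj be_inj alE beE.
have slimP y : inl y \in generated_set (piece x) -> same_piece x y.
  rewrite !inE /= orbF => /imsetP[s]; have [w ->] := to_slim_onto s.
  by rewrite to_slim_piece => xw [->].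
have fatP f : inr f \in generated_set (piece x) -> piece_fat x f.
  rewrite !inE /= => /orP[/imsetP[s _]|/existsP[s]].
    by have [w ->] := to_slim_onto s.
  have [w ->] := to_slim_onto s; rewrite to_slim_piece => /andP[xw wf].
  by exists w.
pose phi (u : line) : build_hoffman a_sym a_irr c_slim :=
  match u with inl y => inl (al y) | inr f => inr (be f) end.
apply: (@hoffman_embedding _ _ (fun u : generated_hoffman (piece x) => phi (val u))).
- move=> [[y|f] u] [[w|g] v] //= [e]; apply: val_inj => /=.
    by rewrite (al_inj y w) //; apply: slimP.
  by rewrite (be_inj f g) //; apply: fatP.
- move=> [[y|f] u] [[w|g] v] //=.
  + by apply: alE; apply: slimP.
  + by apply: beE; [apply: slimP | apply: fatP].
  + by apply: beE; [apply: slimP | apply: fatP].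
- by move=> [[y|f] u].
Qed.

Definition embeds_in_family (W : {set slim_graph line}) :=
  exists (i : 'I_3) (U : {set f_family i}) (hU : hoffman_set U),
  hoffman_isomorphic (generated_hoffman W) (induced_hoffman hU).

(** Without a negative entry the piece is the single vertex [x]. Its at most three fat neighbours
    are numbered by their position in an enumeration, and there [inord] is faithful. *)
Lemma embeds_f1 x : (forall y, T x y != -1) -> embeds_in_family (piece x).
Proof.
move=> noneg.
have single y : same_piece x y -> y = x.
  case/orP => [/eqP->//|xy]; apply/eqP; apply: contraT; rewrite eq_sym => nxy.
  by have [z xz] := negative_partner nxy xy; have := noneg z; rewrite xz eqxx.
exists (Ordinal (isT : (0 < 3)%N)).
apply: (@piece_embedding x _ _ _ _ f1_sym f1_irr f1_inc_slim (fun=> tt)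
  (fun f => inord (index f (enum [set f | inc x f])))).
- by move=> y w /single-> /single->.
- have lt3 f : inc x f -> (index f (enum [set f | inc x f]) < 3)%N.
    move=> xf; apply: leq_trans (fats_le_three x).
    rewrite /common_fats (_ : #|_| = size (enum [set f | inc x f])).
      by rewrite index_mem mem_enum inE.
    by rewrite -cardE; apply: eq_card => h; rewrite !inE andbb.
  move=> f g [_ /single-> xf] [_ /single-> xg] /(congr1 val) /=.
  rewrite !inordK ?lt3 //; apply: (@index_inj _ f); rewrite ?mem_enum ?inE //.
- by move=> y w /single-> /single->; rewrite adj_irr.
- by move=> y f /single-> [_ /single-> ->].
Qed.

(** The piece is just [x] and [z], and both have the same two fat neighbours. *)
Lemma embeds_f3 x z : T x z = -1 -> adj x z -> embeds_in_family (piece x).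
Proof.
move=> xz axz; exists (Ordinal (isT : (2 < 3)%N)).
have cx := class_x x; have cz := class_z xz; have nxz := negative_neq xz.
have classP y := @adjacent_negative_pair _ _ xz _ _ y cx cz xz axz.
have cxz : com x z = 2%N.
  by have := gram_offdiag nxz; rewrite xz axz; lia.
have incE y f : same_piece x y -> piece_fat x f -> inc y f.
  have e (u : G) : com u u = 2%N -> [set f | inc x f && inc z f] \subset [set f | inc u f] ->
      forall f, inc u f -> inc x f && inc z f.
    move=> uu sub g ug.
    have -> : (inc x g && inc z g) = (g \in [set f | inc x f && inc z f]) by rewrite inE.
    have /eqP -> : [set f | inc x f && inc z f] == [set f | inc u f]; last by rewrite inE.
    rewrite eqEcard sub /= -/(com x z) cxz -uu; apply/subset_leq_card/subsetP => h.
    by rewrite !inE => ->.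
  have ex : forall f, inc x f -> inc x f && inc z f.
    by apply: e (class_two_fats xz cx) _; apply/subsetP => h; rewrite !inE => /andP[].
  have ez : forall f, inc z f -> inc x f && inc z f.
    by apply: e (class_two_fats xz cz) _; apply/subsetP => h; rewrite !inE => /andP[].
  move=> /classP yxz [w /classP wxz wf].
  have /andP[xf zf] : inc x f && inc z f by case: wxz wf => ->; [apply: ex | apply: ez].
  by case: yxz => ->.
have [f0 xf0] : exists f0, inc x f0.
  have : (0 < com x x)%N by apply: leq_trans (two_le_fats x).
  by rewrite card_gt0 => /set0Pn[f]; rewrite inE => /andP[]; exists f.
apply: (@piece_embedding x _ _ _ _ f3_sym f3_irr f3_inc_slim (fun y => y == z) (fun f => f == f0)).
- move=> y w /classP[->|->] /classP[->|->] //; first by rewrite (negPf nxz) eqxx.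
  by rewrite (negPf nxz) eqxx.
- move=> f g xf xg; have [->|nf] := eqVneq f f0; have [->|ng] := eqVneq g f0 => // _.
  have : (#|[set f | inc x f] :\ f0| <= 1)%N.
    have := cardsD1 f0 [set f | inc x f]; rewrite inE xf0.
    have <- : com x x = #|[set f | inc x f]|.
      by apply: eq_card => h; rewrite !inE andbb.
    by rewrite (class_two_fats xz cx); lia.
  by move/card_le1_eqP; apply; rewrite !inE ?nf ?ng incE.
- move=> y w; rewrite /f3_slim_rel.
  by move=> /classP[->|->] /classP[->|->]; rewrite ?eqxx ?(negPf nxz) ?adj_irr //=
    ?axz // adj_sym axz.
- by move=> y f xy xf; rewrite /f3_inc incE.
Qed.

Section EmbedF2.
Variables x z : G.
Hypotheses (xz : T x z = -1) (nadj : ~~ adj x z).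

(** An adjacent pair with entry -1 would fill the whole piece, hence consist of [x] and [z], against
    [nadj]. *)
Lemma opposite_pair y w : same_piece x y -> same_piece x w -> T y w = -1 ->
  ~~ adj y w /\ com y w = 1%N.
Proof.
move=> xy xw yw; have na : ~~ adj y w.
  apply: contra nadj => ayw.
  have [ex|ex] := adjacent_negative_pair xz xy xw yw ayw (class_x x);
  have [ez|ez] := adjacent_negative_pair xz xy xw yw ayw (class_z xz).
  - by have := negative_neq xz; rewrite ex ez eqxx.
  - by rewrite ex ez.
  - by rewrite ex ez adj_sym.
  - by have := negative_neq xz; rewrite ex ez eqxx.
by split=> //; have := gram_offdiag (negative_neq yw); rewrite yw (negPf na); lia.
Qed.

(** Vertices of equal sign share no fat vertex, and each shares one with the vertex [w] of the other
    sign. So a sign occurs at most twice. *)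
Lemma no_three_equal y1 y2 y3 w : same_piece x y1 -> same_piece x y2 -> same_piece x y3 ->
    same_piece x w -> y1 != y2 -> y1 != y3 -> y2 != y3 ->
  T x y2 = T x y1 -> T x y3 = T x y1 -> T x w = - T x y1 -> False.
Proof.
move=> c1 c2 c3 cw n12 n13 n23 e2 e3 ew.
have sq : T x y1 * T x y1 = 1 by case: (gram_class_sign xz c1) => ->.
have g12 : T y1 y2 = 1 by rewrite (gram_class_prod xz c1 c2) e2.
have g13 : T y1 y3 = 1 by rewrite (gram_class_prod xz c1 c3) e3.
have g23 : T y2 y3 = 1 by rewrite (gram_class_prod xz c2 c3) e2 e3.
have gw1 : T w y1 = -1 by rewrite (gram_class_prod xz cw c1) ew mulNr sq.
have gw2 : T w y2 = -1 by rewrite (gram_class_prod xz cw c2) ew e2 mulNr sq.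
have gw3 : T w y3 = -1 by rewrite (gram_class_prod xz cw c3) ew e3 mulNr sq.
have [_ w1] := opposite_pair cw c1 gw1; have [_ w2] := opposite_pair cw c2 gw2.
have [_ w3] := opposite_pair cw c3 gw3.
have [_ y12] := positive_pair n12 g12; have [_ y13] := positive_pair n13 g13.
have [_ y23] := positive_pair n23 g23.
exact: (no_three_disjoint (class_two_fats xz cw) w1 w2 w3).
Qed.

(** [y] and [w] have disjoint fat neighbours. Any further vertex of the piece has the opposite sign
    and shares one of its two fat neighbours with each of them. *)
Lemma complementary_fats y w v f : same_piece x y -> same_piece x w -> same_piece x v ->
    y != w -> T x w = T x y -> T x v = - T x y ->
  piece_fat x f -> inc w f = ~~ inc y f.
Proof.
move=> cy cw cv nyw ew ev [u cu uf].
have sq : T x y * T x y = 1 by case: (gram_class_sign xz cy) => ->.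
have gyw : T y w = 1 by rewrite (gram_class_prod xz cy cw) ew.
have [_ yw0] := positive_pair nyw gyw.
have wy0 : com w y = 0%N by rewrite common_fatsC.
have [uy|nuy] := eqVneq u y; first by rewrite -uy uf; rewrite uy in uf; rewrite (common_fats0 yw0).
have [uw|nuw] := eqVneq u w; first by rewrite -uw uf; rewrite uw in uf; rewrite (common_fats0 wy0).
have eu : T x u = - T x y.
  case: (gram_class_sign xz cu) => eu; case: (gram_class_sign xz cy) => ey;
  rewrite eu ey // in ew *; exfalso;
  by apply: (@no_three_equal y w u v); rewrite // ?ew ?eu ?ey // eq_sym.
have guy : T u y = -1 by rewrite (gram_class_prod xz cu cy) eu mulNr sq.
have guw : T u w = -1 by rewrite (gram_class_prod xz cu cw) eu ew mulNr sq.
have [_ uy1] := opposite_pair cu cy guy; have [_ uw1] := opposite_pair cu cw guw.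
case: (boolP (inc y f)) => yf; first by rewrite (common_fats0 yw0).
have [g ug wg] := common_fat_exists uw1.
have yg : ~~ inc y g by rewrite (common_fats0 wy0 wg).
by rewrite (uncommon_fats_uniq (class_two_fats xz cu) uy1 uf yf ug yg).
Qed.

Lemma embeds_f2 : embeds_in_family (piece x).
Proof.
exists (Ordinal (isT : (1 < 3)%N)).
have cx := class_x x; have cz := class_z xz; have nxz := negative_neq xz.
have xx : T x x = 1 by rewrite (gram_mul (y := z)) ?[T z x]gramC ?xz.
have xz1 : com x z = 1%N by case: (opposite_pair cx cz xz).
have zx1 : com z x = 1%N by rewrite common_fatsC.
pose sgn y := T x y == -1.
have sgnx : sgn x = false by rewrite /sgn xx.
have sgnz : sgn z = true by rewrite /sgn xz eqxx.
(* [base y] is the one of [x] and [z] that has the sign of [y]; the piece has at most one further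
   vertex of that sign. *)
pose base y := if sgn y then z else x.
have baseE y : same_piece x y -> T x y = T x (base y).
  by rewrite /base /sgn => /(gram_class_sign xz)[->|->]; rewrite ?eqxx ?xz ?xx.
have cbase y : same_piece x (base y) by rewrite /base; case: ifP.
have other y : same_piece x y -> exists2 v, same_piece x v & T x v = - T x y.
  by move=> cy; rewrite baseE // /base; case: (sgn y); [exists x|exists z] => //; rewrite xx xz.
have neqE y : same_piece x y -> (y != x) && (y != z) = (y != base y).
  rewrite /base => cy; have [->|nx] := eqVneq y x; first by rewrite sgnx eqxx.
  by have [->|nz] := eqVneq y z; [rewrite sgnz eqxx | case: (sgn y)].
have uniq_other y w : same_piece x y -> same_piece x w -> sgn y = sgn w ->
    y != base y -> w != base w -> y = w.
  move=> cy cw e; rewrite {2}/base -e -/(base y) => ny nw.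
  apply/eqP; apply: contraT => nyw; exfalso.
  have [v cv ev] := other y cy.
  have ew : T x w = T x y by rewrite (baseE w cw) (baseE y cy) /base e.
  by apply: (@no_three_equal y w (base y) v) => //; rewrite -baseE.
(* x and z play the roles of x_1 and y_1, so F_ij is determined by whether it
   misses x (i = 2) and whether it misses z (j = 2). *)
apply: (@piece_embedding x _ _ _ _ f2_sym f2_irr f2_inc_slim
  (fun y => (sgn y, (y != x) && (y != z))) (fun f => (~~ inc x f, ~~ inc z f))).
- move=> y w cy cw [e1 e2]; move: e2; rewrite !neqE //.
  have [ey|ny] := eqVneq y (base y); have [ew|nw] := eqVneq w (base w) => // _.
    by rewrite ey ew /base e1.
  exact: uniq_other.
- move=> f g pf pg [/(congr1 negb) + /(congr1 negb)]; rewrite !negbK => ex ez.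
  case: (boolP (inc x f)) (ex) => xf /esym xg; case: (boolP (inc z f)) (ez) => zf /esym zg.
  + exact: (common_fats_uniq xz1).
  + by apply: (uncommon_fats_uniq (class_two_fats xz cx) xz1); rewrite ?zg.
  + by apply: (uncommon_fats_uniq (class_two_fats xz cz) zx1); rewrite ?xg.
  (* Now [f] and [g] both miss [x] and [z]. A vertex [w] on [f] is not [base w], so by
     complementarity it also lies on [g]. It shares exactly one of its two fat neighbours with the
     base vertex of the other sign, and [f] and [g] are both the remaining one. *)
  have [w cw wf] := pf.
  have nw : w != base w.
    by rewrite /base; case: (sgn w); apply: contraTneq wf => ->.
  have [v cv ev] := other (base w) (cbase w).
  have wg : inc w g.
    rewrite (@complementary_fats (base w) w v) ?cbase // 1?eq_sym //; last exact: baseE.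
    by rewrite /base; case: (sgn w); rewrite ?xg ?zg.
  have [v' [cv' gv' nv1 nv2]] : exists v', [/\ same_piece x v', T w v' = -1,
      ~~ inc v' f & ~~ inc v' g].
    exists (if sgn w then x else z).
    have cv' : same_piece x (if sgn w then x else z) by case: ifP.
    split=> //; last 2 first.
    - by case: (sgn w); rewrite -?ex -?ez.
    - by case: (sgn w); rewrite ?xg ?zg.
    rewrite (gram_class_prod xz cw cv') (baseE w cw) /base.
    by case: (sgn w); rewrite ?xx ?xz.
  have [_ c1] := opposite_pair cw cv' gv'.
  exact: (uncommon_fats_uniq (class_two_fats xz cw) c1).
- move=> y w cy cw; rewrite /f2_slim_rel /= !neqE //.
  have [->|nyw] := eqVneq y w; first by rewrite !eqxx adj_irr.
  case: (eqVneq (sgn y) (sgn w)) => [e|ne] /=.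
    have gyw : T y w = 1.
      rewrite (gram_class_prod xz cy cw) (baseE y cy) (baseE w cw) /base e.
      by case: (sgn w); rewrite ?xx ?xz.
    have [-> _] := positive_pair nyw gyw.
    have [ey|ny] := eqVneq y (base y); have [ew|nw] := eqVneq w (base w) => //.
      by move: nyw; rewrite ey ew /base e eqxx.
    by move: nyw; rewrite (uniq_other y w) ?eqxx.
  have gyw : T y w = -1.
    rewrite (gram_class_prod xz cy cw) (baseE y cy) (baseE w cw) /base.
    by move: ne; case: (sgn y); case: (sgn w); rewrite ?xx ?xz.
  by have [/negPf-> _] := opposite_pair cy cw gyw.
- move=> y f cy pf; rewrite /f2_inc /= neqE //.
  have -> : (if sgn y then ~~ inc z f else ~~ inc x f) = ~~ inc (base y) f.
    by rewrite /base; case: (sgn y).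
  have [ey|ny] := eqVneq y (base y); first by rewrite -ey; case: (inc y f).
  have [v cv ev] := other (base y) (cbase y).
  rewrite [RHS](@complementary_fats (base y) y v) ?cbase // 1?eq_sym //; last exact: baseE.
Qed.

End EmbedF2.

Lemma line_line_hoffman : line_hoffman f_family line.
Proof.
(* All fat vertices are already in [F], so [line] serves as its own extension. *)
exists line; split.
  have hT : hoffman_set [set: line].
    by move=> x _ /fat_slim[y sy xy]; exists y; rewrite inE.
  exists [set: line], hT; split; last exact: subsetT.
  exists (fun x => Sub x (in_setT x) : induced_hoffman hT); last by [].
  split; last by [].
  apply: inj_card_bij; first by move=> x y /(congr1 val).
  by rewrite card_sig max_card.
exists pieces; split; first exact: pieces_decomposition.
move=> W /piecesP[x ->]; case: (pickP (fun z => T x z == -1)) => [z /eqP xz|noneg].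
  by case: (boolP (adj x z)) => [|]; [apply: embeds_f3 | apply: embeds_f2].
by apply: embeds_f1 => y; rewrite noneg.
Qed.

End BuildLine.

(** * New fat vertices for classes of one sign *)

Section Augment.
Variables (G : sgraph) (F : finType) (inc : G -> F -> bool).
Hypothesis inc_slim : forall f, exists x, inc x f.
Hypothesis two_le_fats : forall x, (1 < common_fats inc x x)%N.
Hypothesis fats_le_three : forall x, (common_fats inc x x <= 3)%N.
Hypothesis form_ge0 : forall r (X : 'I_r -> G) (a : 'I_r -> int),
  \sum_i `|a i| <= 3 -> 0 <= \sum_i \sum_j a i * a j * gram inc (X i) (X j).

Local Notation T := (gram inc).

Lemma gram3_ge0 x y z (a b c : int) : `|a| + `|b| + `|c| <= 3 ->
  0 <= a * a * T x x + b * b * T y y + c * c * T z z +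
       2 * (a * b * T x y + a * c * T x z + b * c * T y z).
Proof.
move=> abc; have := @form_ge0 3 (fun i => nth x [:: x; y; z] i)
  (fun i => nth 0 [:: a; b; c] i).
rewrite !big_ord_recl !big_ord0 /= !addr0 addrA => /(_ abc).
rewrite (gramC inc y x) (gramC inc z x) (gramC inc z y).
move=> h; apply: le_trans h _; rewrite -subr_ge0.
by rewrite [X in 0 <= X](_ : _ = 0) //; ring.
Qed.

Lemma gram_diag_bounds x : 0 <= T x x <= 1.
Proof.
by rewrite gram_diag; have := two_le_fats x; have := fats_le_three x; lia.
Qed.

(** The vectors [x + y] and [x - y] bound twice the entry by [T x x + T y y], and diagonal entries
    are at most 1. *)
Lemma gram_norm_le1 x y : `|T x y| <= 1.
Proof.
have := @gram3_ge0 x y x 1 1 0; have := @gram3_ge0 x y x 1 (-1) 0.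
have := gram_diag_bounds x; have := gram_diag_bounds y; lia.
Qed.

(** A nonzero entry forces equality in that bound. *)
Lemma gram_neq0_diag x y : T x y != 0 -> T x x = 1 /\ T y y = 1.
Proof.
have := @gram3_ge0 x y x 1 1 0; have := @gram3_ge0 x y x 1 (-1) 0.
have := gram_diag_bounds x; have := gram_diag_bounds y; lia.
Qed.

(* [x - T x y * y] is a null vector of a form that is nonnegative on small
   integer vectors, hence orthogonal to [z]. *)
Lemma gram_mul x y z : T x y != 0 -> T y z != 0 ->
  T x z = T x y * T y z.
Proof.
move=> xy yz; have [xx yy] := gram_neq0_diag xy; have [_ zz] := gram_neq0_diag yz.
have := gram_norm_le1 x y.
have [e|e] : T x y = 1 \/ T x y = -1 by have := gram_norm_le1 x y; lia.
- have := @gram3_ge0 x y z 1 (-1) 1; have := @gram3_ge0 x y z 1 (-1) (-1).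
  by rewrite xx yy zz e; lia.
- have := @gram3_ge0 x y z 1 1 1; have := @gram3_ge0 x y z 1 1 (-1).
  by rewrite xx yy zz e; lia.
Qed.

(** The vertices with exactly two fat neighbours whose class has only one sign. *)
Definition plain x := (T x x == 1) && [forall y, T x y != -1].
(** Represented by the classes themselves, so that each class receives exactly one new fat
    vertex. *)
Definition new_fats : {set {set G}} := [set [set y | T x y != 0] | x in plain].
Definition aug_fat := (F + {S : {set G} | S \in new_fats})%type.
Definition aug_inc x (f : aug_fat) : bool :=
  match f with inl f => inc x f | inr Q => x \in val Q end.

Lemma aug_inc_slim f : exists x, aug_inc x f.
Proof.
case: f => [f|[Q SN]] /=; first exact: inc_slim.
have /imsetP[x /andP[/eqP xx _] ->] := SN; exists x.
by rewrite inE xx.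
Qed.

Lemma plain_gram x y : plain x -> T x y != 0 -> T x y = 1.
Proof. by case/andP => _ /forallP/(_ y); have := gram_norm_le1 x y; lia. Qed.

Lemma plain_trans x y : plain x -> T x y != 0 -> plain y.
Proof.
move=> px xy; have [_ yy] := gram_neq0_diag xy; rewrite /plain yy eqxx /=.
apply/forallP => z; apply/negP => /eqP yz.
have yz0 : T y z != 0 by rewrite yz.
have xz := gram_mul xy yz0; move: xz; rewrite (plain_gram px xy) yz => xz.
by case/andP: px => _ /forallP/(_ z); rewrite xz.
Qed.

(** By [gram_mul] a class is determined by any of its members, so at most one new fat vertex is
    adjacent to [x]. *)
Lemma card_new_fats x y :
  #|[set S : {S : {set G} | S \in new_fats} | (x \in val S) && (y \in val S)]| =
  (plain x && (T x y != 0)).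
Proof.
have newP (S : {S : {set G} | S \in new_fats}) : x \in val S ->
    plain x /\ val S = [set y | T x y != 0].
  have /imsetP[x0 px0 ->] := valP S; rewrite inE => x0x; split.
    exact: plain_trans px0 x0x.
  have xx0 : T x x0 != 0 by rewrite gramC.
  apply/setP => w; rewrite !inE; apply/idP/idP => h.
    by rewrite (gram_mul xx0 h) mulf_neq0.
  by rewrite (gram_mul x0x h) mulf_neq0.
case: (boolP (plain x && _)) => [/andP[px xy]|nxy].
  have [xx _] := gram_neq0_diag xy.
  have SN : [set y | T x y != 0] \in new_fats by apply: imset_f.
  pose S0 : {S : {set G} | S \in new_fats} := Sub [set y | T x y != 0] SN.
  rewrite (_ : [set _ | _] = [set S0]) ?cards1 //.
  apply/setP => S; rewrite !inE -val_eqE /=; apply/idP/eqP => [/andP[xS _]|->].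
    by have [_] := newP S xS.
  by rewrite !inE xx xy.
apply/eqP; rewrite cards_eq0; apply/eqP/setP => S; rewrite !inE.
apply/negP => /andP[xS yS]; have [px eS] := newP S xS.
by move: nxy; rewrite px /=; move: yS; rewrite eS inE => ->.
Qed.

Lemma aug_common_fats x y : common_fats aug_inc x y =
  (common_fats inc x y + (plain x && (T x y != 0)))%N.
Proof.
rewrite -card_new_fats /common_fats.
rewrite -(card_imset _ (@inl_inj F {S : {set G} | S \in new_fats})).
rewrite -[X in (_ + X)%N](card_imset _ (@inr_inj F {S : {set G} | S \in new_fats})).
rewrite -cardsUI [X in (_ + X)%N](_ : _ = 0%N) ?addn0.
  apply: eq_card => -[f|S]; rewrite !inE /=.
    rewrite mem_imset ?inE; last exact: inl_inj.
    by rewrite [X in _ || X](_ : _ = false) ?orbF //; apply/negP => /imsetP[].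
  rewrite orbC mem_imset ?inE; last exact: inr_inj.
  by rewrite [X in _ || X](_ : _ = false) ?orbF //; apply/negP => /imsetP[].
apply: eq_card0 => -[f|S]; rewrite !inE; apply/negP => /andP[].
  by move=> _ /imsetP[].
by move=> /imsetP[].
Qed.

(** On a class of one sign [T] is the all-ones block, which is exactly what its new fat vertex
    subtracts. Each vertex there becomes a piece by itself with three fat neighbours. *)
Lemma aug_gram x y : gram aug_inc x y = if plain x then 0 else T x y.
Proof.
rewrite /gram aug_common_fats PoszD opprD addrA -/(T x y).
case: (boolP (plain x)) => px /=; last by rewrite subr0.
by case: eqVneq => [->|/(plain_gram px)->].
Qed.

Lemma augmented_line_hoffman : exists h : hoffman,
  t_fat 2 h /\ line_hoffman f_family h /\ sgraph_isomorphic G (slim_graph h).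
Proof.
have two x : (1 < common_fats aug_inc x x)%N.
  by rewrite aug_common_fats; apply: leq_trans (two_le_fats x) (leq_addr _ _).
exists (line aug_inc_slim); split; first exact: line_t_fat.
split; last exact: line_slim_graph.
apply: line_line_hoffman => //.
- move=> x y z; rewrite !aug_gram; case: ifP => //= px xy.
  by case: ifP => // py yz; apply: gram_mul.
- by move=> x y; rewrite aug_gram; case: ifP => // _; apply: gram_norm_le1.
- move=> x; have := gram_diag aug_inc x; rewrite aug_gram.
  by have := gram_diag_bounds x; case: (plain x); lia.
- move=> x y _; rewrite aug_gram; case: ifP => // npx xy.
  have [xx _] := gram_neq0_diag xy; move/negbT: (npx); rewrite /plain xx eqxx /=.
  case/forallPn => z; rewrite negbK => /eqP xz.
  by exists z; rewrite aug_gram npx.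
Qed.

End Augment.

Theorem theorem1p8 :
  exists t : nat, (0 < t)%N /\
    forall t1 t2 : nat, (t2 <= t1)%N -> (t <= t2)%N ->
      forall G : sgraph, cospectral G (clique_ext2 (grid t1 t2)) ->
        exists h : hoffman,
          t_fat 2 h /\ line_hoffman f_family h /\
          sgraph_isomorphic G (slim_graph h).
Proof.
(* The thresholds are fixed in the order [m], [p], [N], [R], each depending only on earlier ones and
   not on the graph. The existentials keep the large numerals opaque. *)
have [m m_large] : exists m, (343 < m)%N by exists 344%N.
have [p p_large] : exists p, (9 * (m + 6) < p)%N by eexists; apply: ltnSn.
have [N N_large] : exists N, (144 * (p + m + 6) < N)%N by eexists; apply: ltnSn.
have [R ramseyR] := ramsey N 10.
exists (R + 3)%N; split=> [|t1 t2 t21 Rt2 G cG]; first by rewrite addn3.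
have t20 : (0 < t2)%N by apply: leq_trans Rt2; rewrite addn3.
have [card_G deg_G psd_G second_G] := cospectral_grid_ext_int t20 t21 cG.
apply: (@augmented_line_hoffman G (fat_type G m N) (@incident G m N)).
- exact: (fat_has_slim m_large p_large N_large).
- by move=> x; apply: (two_fats psd_G m_large p_large N_large (ramseyR G) t21 Rt2).
- by move=> x; apply: (few_fats psd_G m_large p_large N_large).
- by move=> r X a; apply: (gram_form_ge0 psd_G m_large p_large N_large).
Qed.
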